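(* Let $d\ge 1$ and let $\omega\sim\mathbb{P}$ be a random environment on $\mathbb{Z}^d$ which is either a random conductances environment or a random traps environment. Suppose that $\mathbb{P}$ is stationary and ergodic with respect to the translations $\tau_x$, $x\in\mathbb{Z}^d$, and that $\mathbb{E}[\pi_\omega(0)]<+\infty$. Let $\mathbf{P}$ be the annealed law of the critical random walk snake started from $0$ in the environment $\omega$. Then exactly one of the following holds: (i) (the critical random walk snake is recurrent) $\mathbf{P}(\forall x\in\mathbb{Z}^d,\ x\text{ is visited infinitely often})=1$; or (ii) (the critical random walk snake is transient) $\mathbf{P}(\exists x\in\mathbb{Z}^d,\ x\text{ is visited infinitely often})=0$.
   Context: Offspring law: $\boldsymbol q=(q_k)_{k\ge0}$ is a fixed probability distribution on $\{0,1,2,\dots\}$ with $\sum_k kq_k=1$, $\sum_k k^3q_k<\infty$ and $\sigma^2:=\sum_k k(k-1)q_k>0$. $\mathcal{T}_\infty$ is Kesten's tree (the Bienaymé-Galton-Watson tree with offspring law $\boldsymbol q$ conditioned to survive): it has an infinite spine $(u_i)_{i\ge0}$ starting at the root $u_0$; spine vertices reproduce independently with law $(kq_k)_{k\ge0}$, one child, chosen uniformly, being the next spine vertex; all other vertices reproduce independently with law $\boldsymbol q$. Environment: write $x\sim y$ if $|x-y|=1$ (Euclidean norm). An environment is a random family $\omega=(\omega_{x,y})_{x,y\in\mathbb{Z}^d}$ of non-negative weights, with law $\mathbb{P}$ and expectation $\mathbb{E}$. Random conductances: $\omega_{x,y}=\omega_{y,x}>0$ if $x\sim y$, $\omega_{x,y}=0$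 otherwise. Random traps: there are random $\rho_x\in[0,1)$, $x\in\mathbb{Z}^d$, with $\omega_{x,x}=\rho_x/(1-\rho_x)$, $\omega_{x,y}=1/(2d)$ if $x\sim y$, and $\omega_{x,y}=0$ otherwise. Set $\pi_\omega(x)=\sum_z\omega_{x,z}$ (so $\pi_\omega(x)=(1-\rho_x)^{-1}$ for traps). The shift is $(\tau_x\omega)_{y,z}=\omega_{y+x,z+x}$. Snake: given $\omega$, the quenched law $\mathbf{P}^\omega$ of the critical random walk snake $\mathcal{S}_{\mathcal{T}_\infty}:\mathcal{T}_\infty\to\mathbb{Z}^d$ is obtained by sampling $\mathcal{T}_\infty$ (independently of $\omega$), placing the root at $0$, and, for each vertex $u$ at position $y$, placing each child of $u$, independently, at $z$ with probability $\omega_{y,z}/\pi_\omega(y)$. The annealed law is $\mathbf{P}=\mathbb{E}\mathbf{P}^\omega$. A site $x$ is visited infinitely often if $\#\mathcal{S}_{\mathcal{T}_\infty}^{-1}(\{x\})=+\infty$. *)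

(* Defs.v *)
From mathcomp Require Import all_boot all_order all_algebra.
From mathcomp Require Import all_classical all_reals all_analysis.

Set Implicit Arguments.
Unset Strict Implicit.
Unset Printing Implicit Defensive.

Import Order.TTheory GRing.Theory Num.Theory.
Import numFieldNormedType.Exports.

Local Open Scope classical_set_scope.
Local Open Scope ring_scope.

Definition critical_offspring (R : realType) (q : nat -> R) : Prop :=
  [/\ forall k, 0 <= q k,
      (\sum_(0 <= k <oo) (q k)%:E = 1)%E,
      (\sum_(0 <= k <oo) (k%:R * q k)%:E = 1)%E,
      (\sum_(0 <= k <oo) (k%:R ^+ 3 * q k)%:E < +oo)%E
    & (0 < \sum_(0 <= k <oo) (k%:R * (k%:R - 1) * q k)%:E)%E].

Definition zd (d : nat) := 'rV[int]_d.

Definition enorm (R : realType) (d : nat) (x : zd d) : R :=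
  Num.sqrt (\sum_(i < d) ((x 0 i)%:~R ^+ 2)).

Definition adj (R : realType) (d : nat) (x y : zd d) : bool :=
  enorm R (x - y) == 1.

Definition weights (R : realType) (d : nat) := zd d -> zd d -> R.

Definition env_cylinders (R : realType) (d : nat) : set (set (weights R d)) :=
  [set A | exists x y : zd d, exists2 B : set R, measurable B &
    A = [set w : weights R d | B (w x y)]].

(* The space of environments, with the product sigma-algebra. *)
Definition env (R : realType) (d : nat) : measurableType _ :=
  g_sigma_algebraType (@env_cylinders R d).

Definition env_shift (R : realType) (d : nat) (x : zd d) (w : env R d)
  : env R d := fun y z => w (y + x) (z + x).

Definition random_conductances (R : realType) (d : nat) (w : env R d) : Prop :=
  forall x y : zd d,
    [/\ w x y = w y x, adj R x y -> 0 < w x y & ~~ adj R x y -> w x y = 0].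

Definition random_traps (R : realType) (d : nat) (w : env R d) : Prop :=
  exists2 rho : zd d -> R, (forall x, 0 <= rho x < 1) &
    forall x y : zd d,
      w x y = if x == y then rho x / (1 - rho x)
              else if adj R x y then ((2 * d)%:R)^-1 else 0.

Definition stationary (R : realType) (d : nat) (P : probability (env R d) R)
  : Prop :=
  forall (x : zd d) (A : set (env R d)), measurable A ->
    P (env_shift x @^-1` A) = P A.

Definition ergodic (R : realType) (d : nat) (P : probability (env R d) R)
  : Prop :=
  forall A : set (env R d), measurable A ->
    (forall x : zd d, env_shift x @^-1` A = A) ->
    P A = 0%E \/ P A = 1%E.

Definition env_pi (R : realType) (d : nat) (w : env R d) (x : zd d) : \bar R :=
  (\esum_(z in [set: zd d]) (w x z)%:E)%E.

Definition trans (R : realType) (d : nat) (w : env R d) (y z : zd d) : R :=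
  w y z / fine (env_pi w y).

(* Vertices are Ulam-Harris words written from the vertex back to the root:
   the root is [::] and the children of u are 0 :: u, 1 :: u, 2 :: u, ... *)
Definition vertex := seq nat.

(* The independent choices out of which Kesten's tree and the snake are built:
   - off_spine u is the number of children of u, used if u is off the spine;
   - on_spine n is the number of children of the n-th spine vertex, and
     next_spine n is the rank of the one that continues the spine;
   - step u y is the site at which u is placed if its parent sits at y; only
     its value at the actual position of the parent is used. *)
Record choices (d : nat) (disp : measure_display) (Om : measurableType disp) :=
  Choices {
    off_spine : vertex -> Om -> nat;
    on_spine : nat -> Om -> nat;
    next_spine : nat -> Om -> nat;
    step : vertex -> zd d -> Om -> zd d;
    measurable_off_spine :
      forall u k, measurable [set o | off_spine u o = k];
    measurable_on_spine :
      forall n k, measurable [set o | on_spine n o = k];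
    measurable_next_spine :
      forall n k, measurable [set o | next_spine n o = k];
    measurable_step :
      forall u y z, measurable [set o | step u y o = z] }.

Section Snake.
Context (d : nat) (disp : measure_display) (Om : measurableType disp).
Variable xi : choices d Om.

Fixpoint spine (o : Om) (n : nat) : vertex :=
  if n is m.+1 then next_spine xi m o :: spine o m else [::].

Definition offspring (o : Om) (u : vertex) : nat :=
  if u == spine o (size u) then on_spine xi (size u) o else off_spine xi u o.

Fixpoint in_tree (o : Om) (u : vertex) : bool :=
  if u is j :: v then in_tree o v && (j < offspring o v)%N else true.

Fixpoint snake (o : Om) (u : vertex) : zd d :=
  if u is _ :: v then step xi u (snake o v) o else 0.

Definition visits (o : Om) (x : zd d) : set vertex :=
  [set u | in_tree o u /\ snake o u = x].

Definition visited_io (o : Om) (x : zd d) : Prop := infinite_set (visits o x).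

End Snake.

(* All choices are mutually independent (the product rule over finite
   subfamilies), with marginals: q for off_spine u; for the pair
   (on_spine n, next_spine n), the law (k q_k)_k for the first component and,
   given that it is k, the uniform law on {0, ..., k - 1} for the second one;
   w_{y,.} / pi_w(y) for step u y. *)
Definition quenched_law (R : realType) (d : nat) (q : nat -> R) (w : env R d)
    (disp : measure_display) (Om : measurableType disp)
    (xi : choices d Om) (mu : set Om -> \bar R) : Prop :=
  forall (U : seq vertex) (n : nat) (V : seq (vertex * zd d))
         (a : vertex -> nat) (b c : nat -> nat) (z : vertex * zd d -> zd d),
    uniq U -> uniq V ->
    mu [set o | [/\ forall u, u \in U -> off_spine xi u o = a u,
                    forall i, (i < n)%N ->
                      on_spine xi i o = b i /\ next_spine xi i o = c i
                  & forall v, v \in V -> step xi v.1 v.2 o = z v]] =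
    ((\prod_(u <- U) q (a u)) *
     (\prod_(i < n) (((b i)%:R * q (b i)) *
                     (if (c i < b i)%N then ((b i)%:R)^-1 else 0))) *
     (\prod_(v <- V) trans w v.2 (z v)))%:E.

Definition annealed (R : realType) (d : nat) (P : probability (env R d) R)
    (disp : measure_display) (Om : measurableType disp)
    (Q : R.-pker (env R d) ~> Om) (A : set Om) : \bar R :=
  (\int[P]_w Q w A)%E.

(* Main.v *)
From HB Require Import structures.
Require Import Defs.
From mathcomp Require Import all_boot all_order all_algebra.
From mathcomp Require Import all_classical all_reals all_analysis.
From mathcomp Require Import measurable_realfun ring lra zify.

(* Let h(w) be the quenched probability that some site is visited infinitely
   often. The bushes hanging off the spine are critical, hence almost surely
   finite, so that event is unchanged when the snake is restarted from a spine
   vertex: h is harmonic for the environment seen from the spine, which is a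
   random walk in w. As the weights are symmetric and E[pi_w(0)] is finite, the
   Dirichlet form of h under P vanishes, so h is almost surely invariant under
   all translations. The same restart property then makes the event independent
   of every cylinder, whence h = h^2, and ergodicity makes h constant, 0 or 1.
   Finally, whenever a vertex is placed at x, it has a child placed at the
   neighbour y with a probability bounded below independently of the past, so
   infinitely many visits of x force infinitely many visits of y. *)

Set Implicit Arguments.
Unset Strict Implicit.
Unset Printing Implicit Defensive.

Import Order.TTheory GRing.Theory Num.Theory.
Import numFieldNormedType.Exports.

Local Open Scope classical_set_scope.
Local Open Scope ring_scope.

(** Restarting at a spine vertex forgets a finite but random part of the tree and moves the origin
    to a random site. To control both, all independent choices are read as one configuration of
    marks indexed by labels, where steps are recorded as increments. Restarting at a vertex [v]
    placed at [x] is then the injective relabelling [rebase v x], which turns the product law in [w]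
    into the product law in the environment shifted by [x]. No measure is constructed: laws are
    given by their values on cylinders and compared there. The spine vertex and its position take
    countably many values, so the Markov property follows by summing over them, each summand
    expressing independence of two disjoint sets of labels. Invariance of h has to precede the
    quenched zero-one law: given the past, the restarted event has probability h in the environment
    seen from the new site, and this factors out only once it is known to equal h(w). *)

(** Finite subsums give the inequality [<=]; the reverse one is the same inequality for the inverse
    of [c] and the family [c * a]. *)
Lemma esumZl (R : realType) (T : choiceType) (D : set T) (c : \bar R)
    (a : T -> \bar R) : (0 <= c)%E -> c \is a fin_num -> (forall t, 0 <= a t)%E ->
  (\esum_(t in D) (c * a t) = c * \esum_(t in D) a t)%E.
Proof.
move=> c0 cfin a0.
have le (k : \bar R) (b : T -> \bar R) : (0 <= k)%E -> (forall t, 0 <= b t)%E ->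
    (\esum_(t in D) (k * b t) <= k * \esum_(t in D) b t)%E.
  move=> k0 b0; apply: ub_ereal_sup => _ [F [finF FD] <-].
  rewrite -ge0_mule_fsumr //; apply: lee_wpmul2l => //.
  by apply: esum_ge; exists F => //; split.
apply/eqP; rewrite eq_le le //=.
have [->|cN0] := eqVneq c 0%E.
  by rewrite mul0e; apply: esum_ge0 => t _; rewrite mul0e.
have c_gt0 : (0 < c)%E by rewrite lt0e cN0.
case: c c0 cfin cN0 c_gt0 le => // r _ _ rN0; rewrite lte_fin => r0 le.
rewrite muleC -lee_pdivlMr //.
have := le (r^-1)%:E (fun t => r%:E * a t)%E.
under eq_esum do rewrite muleA -EFinM mulVf ?gt_eqF// mul1e.
rewrite muleC; apply; first by rewrite lee_fin invr_ge0 ltW.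
by move=> t; rewrite mule_ge0 // lee_fin ltW.
Qed.

(** * Measurability and total probability for countably valued maps *)

Section CountablyValued.
Context (disp : measure_display) (Om : measurableType disp).

Lemma measurable_forall (K : choiceType) (P : K -> Om -> Prop) :
  countable [set: K] -> (forall k, measurable [set o | P k o]) ->
  measurable [set o | forall k, P k o].
Proof.
move=> cK mP.
have -> : [set o | forall k, P k o] = ~` \bigcup_(k in [set: K]) ~` [set o | P k o].
  apply/seteqP; split => o /=; first by move=> Po [k _]; apply.
  by move=> nP k; apply: contrapT => nPk; apply: nP; exists k.
apply: measurableC; apply: countable_bigcupT_measurable => // k.
exact: measurableC.
Qed.

Lemma measurable_exists (K : choiceType) (P : K -> Om -> Prop) :
  countable [set: K] -> (forall k, measurable [set o | P k o]) ->
  measurable [set o | exists k, P k o].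
Proof.
move=> cK mP.
have -> : [set o | exists k, P k o] = \bigcup_(k in [set: K]) [set o | P k o].
  by apply/seteqP; split => o /=; [move=> [k ?]; exists k|move=> [k _ ?]; exists k].
exact: countable_bigcupT_measurable.
Qed.

Lemma measurable_negation (P : Om -> Prop) :
  measurable [set o | P o] -> measurable [set o | ~ P o].
Proof. exact: measurableC. Qed.

Lemma measurable_conj (P P' : Om -> Prop) :
  measurable [set o | P o] -> measurable [set o | P' o] ->
  measurable [set o | P o /\ P' o].
Proof. exact: measurableI. Qed.

Lemma measurable_impl (P P' : Om -> Prop) :
  measurable [set o | P o] -> measurable [set o | P' o] ->
  measurable [set o | P o -> P' o].
Proof.
move=> mP mP'.
rewrite (_ : mkset _ = ~` [set o | P o] `|` [set o | P' o]); last first.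
  apply/seteqP; split => o /=; last by case.
  by case: (pselect (P o)) => [p /(_ p)|]; [right|left].
by apply: measurableU => //; exact: measurableC.
Qed.

Lemma measurable_const (P : Prop) : measurable [set _ : Om | P].
Proof.
case: (pselect P) => p.
  by rewrite (_ : mkset _ = setT) //; apply/seteqP; split.
by rewrite (_ : mkset _ = set0) //; apply/seteqP; split.
Qed.

(** Vertices, positions and numbers of children range over countable sets, so measurable level sets
    suffice and the target needs no sigma-algebra. *)
Definition discretely_measurable (T : choiceType) (X : Om -> T) : Prop :=
  forall t, measurable [set o | X o = t].

(** A random index may be substituted into a family of events: split over its countably many
    values. *)
Lemma measurable_bind (T : choiceType) (X : Om -> T) (P : T -> Om -> Prop) :
  countable [set: T] -> discretely_measurable X ->
  (forall t, measurable [set o | P t o]) -> measurable [set o | P (X o) o].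
Proof.
move=> cT mX mP.
rewrite (_ : mkset _ = [set o | exists t, X o = t /\ P t o]).
  by apply: measurable_exists => // t; exact: measurable_conj.
apply/seteqP; split => o /=; first by exists (X o).
by move=> [t [-> ?]].
Qed.

Lemma discretely_measurable_bind (T U : choiceType) (X : Om -> T)
    (Y : T -> Om -> U) :
  countable [set: T] -> discretely_measurable X ->
  (forall t, discretely_measurable (Y t)) ->
  discretely_measurable (fun o => Y (X o) o).
Proof.
move=> cT mX mY u.
by apply: (measurable_bind (P := fun t o => Y t o = u)) => // t; exact: mY.
Qed.

Lemma measurable_discrete (T : choiceType) (X : Om -> T) (B : set T) :
  countable [set: T] -> discretely_measurable X -> measurable [set o | B (X o)].
Proof.
by move=> cT mX; apply: (measurable_bind (P := fun t _ => B t)) => // t;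
  exact: measurable_const.
Qed.

(** Countable additivity over the fibres of [X]. The injection [g] into [nat] only numbers the
    fibres; the sum is carried back to [T] at the end. *)
Lemma total_probability (R : realType) (mu : {measure set Om -> \bar R})
    (T : choiceType) (X : Om -> T) (A : set Om) :
  countable [set: T] -> discretely_measurable X -> measurable A ->
  mu A = (\esum_(t in [set: T]) mu (A `&` [set o | X o = t]))%E.
Proof.
move=> /countable_injP[g ginj] mX mA.
have {}ginj : injective g by move=> x y; apply: ginj; rewrite inE.
pose F n := A `&` [set o | g (X o) = n].
have AE : A = \bigcup_(n in range g) F n.
  apply/seteqP; split => o /=; last by move=> [_ [t _ <-] []].
  by move=> Ao; exists (g (X o)); [exists (X o)|split].
have Fg t : F (g t) = A `&` [set o | X o = t].
  by apply/seteqP; split => o /= [Ao XE]; split=> //; [exact: ginj|rewrite /= XE].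
rewrite {1}AE measure_bigcup; last 2 first.
- by move=> _ [t _ <-]; rewrite Fg; apply: measurableI => //; exact: mX.
- apply/trivIsetP => i j _ _ /eqP ij.
  rewrite -subset0 => o [[_ /= Xi] [_ /= Xj]].
  exact: ij (etrans (esym Xi) Xj).
rewrite nneseries_esum; last by move=> *; exact: measure_ge0.
rewrite (_ : [set x | x \in range g] = range g); last first.
  by apply/seteqP; split => x /=; rewrite inE.
rewrite esum_image; last by move=> x y _ _; exact: ginj.
by apply: eq_esum => t _; rewrite Fg.
Qed.

End CountablyValued.

(** * Product laws on configurations *)

Section Configurations.
Context (I : choiceType) (T : pointedType).

Definition coordinate_events : set (set (I -> T)) :=
  [set A | exists i t, A = [set f | f i = t]].

Definition conf : measurableType _ := g_sigma_algebraType coordinate_events.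

Definition cylinder (s : seq I) (a : I -> T) : set conf :=
  [set f | forall i, i \in s -> f i = a i].

Lemma measurable_coordinate i :
  discretely_measurable (fun f : conf => f i).
Proof. by move=> t; apply: sub_sigma_algebra; exists i, t. Qed.

Lemma measurable_to_conf disp (Om : measurableType disp) (X : Om -> conf) :
  (forall i, discretely_measurable (fun o => X o i)) ->
  measurable_fun setT X.
Proof.
move=> mX; apply: (measurability (rT := conf) coordinate_events) => //.
by move=> _ [_ [i [t ->]] <-]; rewrite setTI; exact: mX.
Qed.

Lemma cylinder0 a : cylinder [::] a = setT.
Proof. by apply/seteqP; split. Qed.

Lemma cylinder_cons i s a :
  cylinder (i :: s) a = [set f | f i = a i] `&` cylinder s a.
Proof.
apply/seteqP; split => f /=.
  by move=> fa; split=> [|j js]; apply: fa; rewrite inE ?eqxx ?js ?orbT.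
by move=> [fi fs] j; rewrite inE => /predU1P[->//|/fs].
Qed.

Lemma measurable_cylinder s a : measurable (cylinder s a).
Proof.
elim: s => [|i s IHs]; first by rewrite cylinder0.
by rewrite cylinder_cons; apply: measurableI => //; exact: measurable_coordinate.
Qed.

(** Cylinders and the empty set form a pi-system generating the sigma-algebra: if two cylinders
    share a point [f], their intersection is the cylinder that prescribes [f] on both index
    lists. *)
Lemma conf_measure_unique (R : realType) (m1 m2 : {measure set conf -> \bar R}) :
  (forall s a, uniq s -> m1 (cylinder s a) = m2 (cylinder s a)) ->
  (m1 setT < +oo)%E ->
  forall A, measurable A -> m1 A = m2 A.
Proof.
move=> m12 fin1 A mA.
pose G : set (set conf) :=
  [set B | B = set0 \/ exists s a, uniq s /\ B = cylinder s a].
pose H := [set X | G X /\ X `<=` setT].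
have mH : H `<=` measurable.
  by move=> B [[->//|[s [a [_ ->]]]] _]; exact: measurable_cylinder.
apply: (g_sigma_algebra_measure_unique_trace G setT _ mH) => //.
- move=> B C [GB _] [GC _]; split => //.
  case: GB => [->|[s [a [us ->]]]]; first by rewrite set0I; left.
  case: GC => [->|[s' [a' [us' ->]]]]; first by rewrite setI0; left.
  case: (pselect (cylinder s a `&` cylinder s' a' = set0)) => [->|]; first by left.
  move/eqP/set0P => [f [fs fs']]; right; exists (undup (s ++ s')), f.
  split; first exact: undup_uniq.
  apply/seteqP; split => g /=.
    move=> [gs gs'] i; rewrite mem_undup mem_cat => /orP[is_|is_].
      by rewrite gs // fs.
    by rewrite gs' // fs'.
  move=> gf; split => i is_; rewrite gf ?mem_undup ?mem_cat ?is_ ?orbT//.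
    by rewrite fs.
  by rewrite fs'.
- by have := m12 [::] point isT; rewrite cylinder0.
- by move=> B [[->|[s [a [us ->]]]] _]; [rewrite !measure0|exact: m12].
- have : <<s coordinate_events >> `<=` <<s H >>.
    apply: smallest_sub; first exact: smallest_sigma_algebra.
    move=> _ [i [t ->]]; apply: sub_sigma_algebra; split=> //; right.
    exists [:: i], (fun=> t); split => //.
    by rewrite cylinder_cons cylinder0 setIT.
  by apply.
Qed.

End Configurations.

Section ImageMeasure.
Context (d1 d2 : measure_display) (T1 : measurableType d1)
  (T2 : measurableType d2) (R : realType).

(** The pushforward as a bundled measure; its measure structure depends on the proof [mf], so the
    instance is named explicitly. *)
Definition image_measure (mu : {measure set T1 -> \bar R}) (f : T1 -> T2)
    (mf : measurable_fun setT f) : {measure set T2 -> \bar R} :=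
  measure_function_pushforward__canonical__measure_function_Measure mu mf.

End ImageMeasure.

Section ProductLaw.
Context (R : realType) (T : pointedType).

(** A characterization of a given measure, which determines it ([product_law_unique]), rather than a
    construction. *)
Definition product_law (I : choiceType) (p : I -> T -> R)
    (mu : {measure set (conf I T) -> \bar R}) : Prop :=
  forall s a, uniq s -> mu (cylinder s a) = (\prod_(i <- s) p i (a i))%:E.

(** One implication is enough, since [f] and [g] can be exchanged. *)
Definition depends_on (I : choiceType) (D : set I) (A : set (conf I T)) : Prop :=
  forall f g : conf I T, (forall i, D i -> f i = g i) -> A f -> A g.

Definition precompose (I K : choiceType) (J : I -> K) (f : conf K T) : conf I T :=
  fun i => f (J i).

(** An event depending on [D] is its own preimage under [freeze D]; this turns functional dependence
    into a statement about pushforward measures. *)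
Definition freeze (I : choiceType) (D : set I) (f : conf I T) : conf I T :=
  fun i => if `[< D i >] then f i else point.

Section Basics.
Context (I : choiceType).
Implicit Types (p : I -> T -> R) (mu nu : {measure set (conf I T) -> \bar R}).

Lemma product_lawT p mu : product_law p mu -> mu setT = 1%E.
Proof. by move=> /(_ [::] point isT); rewrite cylinder0 big_nil. Qed.

Lemma product_law_unique p mu nu : product_law p mu -> product_law p nu ->
  forall A, measurable A -> mu A = nu A.
Proof.
move=> pmu pnu; apply: conf_measure_unique => [s a us|].
  by rewrite pmu // pnu.
by rewrite (product_lawT pmu) ltry.
Qed.

Lemma product_law_le1 p mu A : product_law p mu -> measurable A -> (mu A <= 1)%E.
Proof.
move=> pmu mA; rewrite -(product_lawT pmu); apply: le_measure; rewrite ?inE//.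
Qed.

Lemma product_law_fin p mu A :
  product_law p mu -> measurable A -> mu A \is a fin_num.
Proof.
move=> pmu mA; rewrite ge0_fin_numE ?measure_ge0//.
by rewrite (le_lt_trans (product_law_le1 pmu mA)) ?ltry.
Qed.

Lemma product_law_setC p mu A :
  product_law p mu -> measurable A -> mu (~` A) = (1 - mu A)%E.
Proof.
move=> pmu mA; have fT : (mu setT < +oo)%E by rewrite (product_lawT pmu) ltry.
rewrite -setTD measureD//.
by rewrite setTI; congr (_ - _)%E; exact: product_lawT pmu.
Qed.

Lemma measurable_freeze (D : set I) : measurable_fun setT (@freeze I D).
Proof.
apply: measurable_to_conf => i t; rewrite /freeze.
case: asboolP => Di; first exact: measurable_coordinate.
exact: measurable_const.
Qed.

Lemma freeze_dep (D : set I) A : depends_on D A -> A = freeze D @^-1` A.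
Proof.
move=> dA; apply/seteqP; split=> f /=.
  by apply: dA => i Di; rewrite /freeze asboolT.
by apply: dA => i Di; rewrite /freeze asboolT.
Qed.

(** A prescription outside [D] is either incompatible with the default value, which makes the
    preimage empty, or automatically satisfied, so that only indices in [D] remain. *)
Lemma freeze_cylinder (D : set I) s a : uniq s ->
  freeze D @^-1` cylinder s a = set0 \/
  exists2 s', uniq s' /\ (forall i, i \in s' -> D i) &
    freeze D @^-1` cylinder s a = cylinder s' a.
Proof.
move=> us.
case: (pselect (exists2 i, i \in s & ~ D i /\ a i <> point)) => [[i is_ [nD ai]]|h].
  left; rewrite -subset0 => f /= /(_ i is_); rewrite /freeze asboolF // => /esym.
  exact: ai.
right; exists [seq i <- s | `[< D i >]].
  split; first exact: filter_uniq.
  by move=> i; rewrite mem_filter => /andP[/asboolP].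
apply/seteqP; split => f /=.
  move=> fa i; rewrite mem_filter => /andP[Di is_].
  by rewrite -fa // /freeze Di.
move=> fa i is_; rewrite /freeze; case: ifPn => Di.
  by rewrite fa // mem_filter Di.
by apply: contrapT => ai; apply: h; exists i => //; split; [exact/asboolPn|exact/nesym].
Qed.

Lemma cylinder_cat s s' (a : I -> T) :
  cylinder (s ++ s') a = cylinder s a `&` cylinder s' a.
Proof.
apply/seteqP; split => f /=.
  by move=> fa; split=> i is_; apply: fa; rewrite mem_cat is_ ?orbT.
by move=> [fa fa'] i; rewrite mem_cat => /orP[/fa|/fa'].
Qed.

Lemma eq_cylinder s (a b : I -> T) :
  (forall i, i \in s -> a i = b i) -> cylinder s a = cylinder s b.
Proof.
by move=> ab; apply/seteqP; split => f fs i is_; rewrite fs // ab.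
Qed.

(* Two applications of uniqueness: first to A with B a cylinder, then to B. *)
Lemma product_law_indep p mu (D D' : set I) A B : product_law p mu ->
  (forall i, D i -> D' i -> False) ->
  depends_on D A -> depends_on D' B -> measurable A -> measurable B ->
  mu (A `&` B) = (mu A * mu B)%E.
Proof.
move=> pmu DD' dA dB mA mB.
have fz (E : set I) (C : set (conf I T)) : measurable C ->
    measurable (freeze E @^-1` C).
  by move=> mC; rewrite -[X in measurable X]setTI; exact: measurable_freeze.
have fin C (mC : measurable C) := product_law_fin pmu mC.
have cyl_indep s s' a a' : uniq s -> uniq s' ->
    (forall i, i \in s -> D i) -> (forall i, i \in s' -> D' i) ->
    mu (cylinder s a `&` cylinder s' a') =
      (mu (cylinder s a) * mu (cylinder s' a'))%E.
  move=> us us' sD sD'.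
  pose b i := if i \in s then a i else a' i.
  have bs i : i \in s -> a i = b i by rewrite /b => ->.
  have bs' i : i \in s' -> a' i = b i.
    by rewrite /b; case: ifPn => // is_ is'; case: (DD' i (sD i is_) (sD' i is')).
  have uss : uniq (s ++ s').
    rewrite cat_uniq us us' andbT /=; apply/hasPn => i is'; apply/negP => is_.
    exact: (DD' i (sD i is_) (sD' i is')).
  rewrite (eq_cylinder bs) (eq_cylinder bs') -cylinder_cat !pmu //.
  by rewrite big_cat EFinM.
(* Extension from cylinders to [C]: both sides are finite measures in [C], namely the pushforwards
   by [freeze E] of [mu] restricted to [C'] and of [mu] scaled by [mu C']. *)
have step (C C' : set (conf I T)) (E : set I) : measurable C -> measurable C' ->
    (forall s a, uniq s -> mu (freeze E @^-1` cylinder s a `&` C') =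
       (mu (freeze E @^-1` cylinder s a) * mu C')%E) ->
    mu (freeze E @^-1` C `&` C') = (mu (freeze E @^-1` C) * mu C')%E.
  move=> mC mC' H.
  have r0 : (0 <= fine (mu C'))%R by rewrite fine_ge0.
  pose m1 := image_measure (mrestr mu mC') (measurable_freeze E).
  pose m2 := mscale (NngNum r0) (image_measure mu (measurable_freeze E)).
  have E2 X : m2 X = (mu (freeze E @^-1` X) * mu C')%E.
    by rewrite -[mu C']fineK ?fin // muleC.
  rewrite -E2; apply: (@conf_measure_unique I T R m1 m2) => //.
    by move=> s a us; apply: etrans (esym (E2 _)); exact: H.
  by rewrite ltey_eq; apply/orP; left; apply: fin; rewrite preimage_setT setTI.
rewrite (freeze_dep dA) (freeze_dep dB).
apply: (step A (freeze D' @^-1` B) D) => //; first exact: fz.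
move=> s a us.
case: (freeze_cylinder D a us) => [->|[s' [us' s'D] ->]].
  by rewrite set0I measure0 mul0e.
rewrite setIC muleC; apply: (step B (cylinder s' a) D') => //.
  exact: measurable_cylinder.
move=> t b ut.
case: (freeze_cylinder D' b ut) => [->|[t' [ut' t'D] ->]].
  by rewrite set0I measure0 mul0e.
by rewrite setIC muleC; exact: cyl_indep.
Qed.

Lemma depends_onI (D : set I) A B : depends_on D A -> depends_on D B ->
  depends_on D (A `&` B).
Proof. by move=> dA dB f g fg [/(dA _ _ fg) ? /(dB _ _ fg)]. Qed.

Lemma depends_onC (D : set I) A : depends_on D A -> depends_on D (~` A).
Proof.
move=> dA f g fg nA Ag; apply: nA; apply: dA Ag => i Di.
exact/esym/fg.
Qed.

Lemma depends_onS (D D' : set I) A :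
  D `<=` D' -> depends_on D A -> depends_on D' A.
Proof. by move=> DD' dA f g fg; apply: dA => i /DD'; exact: fg. Qed.

Lemma product_law_coordinate p mu (i : I) (B : set T) :
  countable [set: T] -> product_law p mu ->
  mu [set f | B (f i)] = (\esum_(t in B) (p i t)%:E)%E.
Proof.
move=> cT pmu.
have mfi := @measurable_coordinate I T i.
rewrite (total_probability mu cT mfi); last exact: measurable_discrete.
rewrite [RHS]esum_mkcond; apply: eq_esum => t _.
have cylE : [set f : conf I T | f i = t] = cylinder [:: i] (fun=> t).
  by rewrite cylinder_cons cylinder0 setIT.
case: ifPn => [|/negP] Bt; rewrite inE in Bt.
  rewrite (_ : _ `&` _ = [set f | f i = t]); last first.
    by apply/seteqP; split=> f /= => [[]//|fit]; rewrite fit.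
  by rewrite cylE pmu // big_seq1.
by rewrite (_ : _ `&` _ = set0) ?measure0// -subset0 => f /= [] /[swap] ->.
Qed.

Lemma product_law_marginal p mu (i : I) s a :
  countable [set: T] -> (forall t, 0 <= p i t) ->
  (\esum_(t in [set: T]) (p i t)%:E = 1)%E -> i \notin s ->
  (forall b, mu (cylinder (i :: s) b) = (\prod_(j <- i :: s) p j (b j))%:E) ->
  mu (cylinder s a) = (\prod_(j <- s) p j (a j))%:E.
Proof.
move=> cT p0 p1 nis H.
rewrite (total_probability mu cT (@measurable_coordinate I T i)); last first.
  exact: measurable_cylinder.
pose c := \prod_(j <- s) p j (a j).
have E t : mu (cylinder s a `&` [set f | f i = t]) = (p i t * c)%:E.
  pose b j := if j == i then t else a j.
  have bs j : j \in s -> a j = b j.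
    by rewrite /b; case: eqP => // -> is_; rewrite is_ in nis.
  have bi : b i = t by rewrite /b eqxx.
  rewrite (eq_cylinder bs) setIC -[t in [set f | f i = t]]bi -cylinder_cons H.
  rewrite big_cons bi; congr (_ * _)%:E; rewrite [RHS]big_seq big_seq.
  by apply: eq_bigr => j js; rewrite bs.
(* Since the [p i t] sum to 1, one of them is positive, and for it [p i t * c] is the measure of an
   event. *)
have c0 : (0 <= c%:E)%E.
  case: (pselect (exists t, 0 < p i t)) => [[t pt]|np].
    have : (0 <= (p i t * c)%:E)%E by rewrite -E; exact: measure_ge0.
    by rewrite !lee_fin pmulr_rge0.
  suff : (1 = 0 :> \bar R)%E by move/eqP; rewrite gt_eqF ?lte01.
  rewrite -p1; apply: esum1 => t _; congr (_%:E); apply/eqP.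
  by rewrite eq_le p0 andbT leNgt; apply/negP => pt; apply: np; exists t.
rewrite (eq_esum (b := fun t => (c%:E * (p i t)%:E)%E)); last first.
  by move=> t _; rewrite -EFinM mulrC; exact: E.
by rewrite esumZl // ?p1 ?mule1 // => t; rewrite lee_fin.
Qed.

End Basics.

Lemma measurable_precompose (I K : choiceType) (J : I -> K) :
  measurable_fun setT (@precompose I K J).
Proof.
by apply: measurable_to_conf => i; exact: measurable_coordinate.
Qed.

Lemma product_law_precompose (I K : choiceType) (J : I -> K) (p : K -> T -> R)
    (mu : {measure set (conf K T) -> \bar R}) :
  injective J -> product_law p mu ->
  product_law (fun i => p (J i)) (image_measure mu (measurable_precompose J)).
Proof.
move=> injJ pmu s a us.
(* The prescription [a] carried along [J]; injectivity makes it consistent, and off the range of [J]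
   any value will do. *)
pose b k := if pselect (exists i, J i = k) is left e then a (projT1 (cid e))
            else point.
have bJ i : b (J i) = a i.
  rewrite /b; case: pselect => [e|]; last by case; exists i.
  by congr a; apply: injJ; exact: projT2 (cid e).
have -> : image_measure mu (measurable_precompose J) (cylinder s a) =
    mu (cylinder (map J s) b).
  rewrite /image_measure /= /pushforward; congr (mu _); apply/seteqP.
  split => f /= fs.
    by move=> k /mapP[i is_ ->]; rewrite bJ; exact: fs.
  by move=> i is_; rewrite -bJ; apply: fs; exact: map_f.
rewrite pmu ?map_inj_uniq // big_map; congr (_%:E).
by apply: eq_bigr => i _; rewrite bJ.
Qed.
End ProductLaw.

(** * The snake as a function of a configuration *)

HB.instance Definition _ := isPointed.Build int 0.

Section CanonicalChoices.
Context (d : nat).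

Definition label := (vertex + nat + vertex * zd d)%type.

Definition Off (u : vertex) : label := inl (inl u).
Definition Spine (n : nat) : label := inl (inr n).
Definition Step (u : vertex) (y : zd d) : label := inr (u, y).

(* Off u carries (off_spine u, 0, 0), Spine n carries
   (on_spine n, next_spine n, 0) and Step u y carries (0, 0, step u y - y):
   recording increments makes translations act on indices only. *)
Definition mark := (nat * nat * zd d)%type.

Definition config := conf label mark.

Lemma countable_mark : countable [set: mark].
Proof. exact: countableP. Qed.

Lemma measurable_mark (i : label) (B : set mark) :
  measurable [set f : config | B (f i)].
Proof.
apply: measurable_discrete; first exact: countable_mark.
exact: measurable_coordinate.
Qed.

(** The universal instance, whose sample is the configuration itself; any other instance factors
    through it by [to_config]. *)
Definition config_choices : choices d config.
Proof.
refine (@Choices d _ config (fun u f => (f (Off u)).1.1)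
  (fun n f => (f (Spine n)).1.1) (fun n f => (f (Spine n)).1.2)
  (fun u y f => y + (f (Step u y)).2) _ _ _ _) => *.
- exact: (@measurable_mark _ [set t | t.1.1 = _]).
- exact: (@measurable_mark _ [set t | t.1.1 = _]).
- exact: (@measurable_mark _ [set t | t.1.2 = _]).
- exact: (@measurable_mark _ [set t | _ + t.2 = _]).
Defined.

Local Notation spn := (spine config_choices).
Local Notation off := (offspring config_choices).
Local Notation tree := (in_tree config_choices).
Local Notation pos := (snake config_choices).

Lemma size_spine (f : config) n : size (spn f n) = n.
Proof. by elim: n => //= n ->. Qed.

Lemma measurable_spine n : discretely_measurable (fun f => spn f n).
Proof.
elim: n => [|n IHn] u /=; first exact: measurable_const.
apply: (measurable_bind (X := fun f => spn f n)
  (P := fun t f => (f (Spine n)).1.2 :: t = u)) => //.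
  exact: countableP.
by move=> t; exact: (@measurable_mark _ [set x | x.1.2 :: t = u]).
Qed.

Lemma measurable_offspring u : discretely_measurable (fun f => off f u).
Proof.
move=> k; rewrite /offspring.
apply: (measurable_bind (X := fun f => spn f (size u))
  (P := fun t f => (if u == t then (f (Spine (size u))).1.1
                   else (f (Off u)).1.1) = k)).
- exact: countableP.
- exact: measurable_spine.
move=> t; case: eqP => _.
  exact: (@measurable_mark _ [set x | x.1.1 = k]).
exact: (@measurable_mark _ [set x | x.1.1 = k]).
Qed.

Lemma measurable_in_tree u : measurable [set f | tree f u].
Proof.
elim: u => [|j u IHu] /=; first exact: measurable_const.
rewrite (_ : mkset _ = [set f | tree f u /\ (j < off f u)%N]); last first.
  by apply/seteqP; split => f /= /andP.
apply: (measurable_conj (P := fun f => tree f u)) => //.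
apply: (measurable_discrete [set k | (j < k)%N]); first exact: countableP.
exact: measurable_offspring.
Qed.

Lemma measurable_snake u : discretely_measurable (fun f => pos f u).
Proof.
elim: u => [|j u IHu] x /=; first exact: measurable_const.
apply: (measurable_bind (X := fun f => pos f u)
  (P := fun y f => y + (f (Step (j :: u) y)).2 = x)) => //.
  exact: countableP.
by move=> y; exact: (@measurable_mark _ [set t | y + t.2 = x]).
Qed.

(** A set is finite when some list contains it, and there are only countably many lists of
    vertices. *)
Lemma measurable_finite_vertices (P : vertex -> config -> Prop) :
  (forall u, measurable [set f | P u f]) ->
  measurable [set f | finite_set [set u | P u f]].
Proof.
move=> mP.
rewrite (_ : mkset _ = [set f | exists s : seq vertex, forall u, P u f -> u \in s]).
  apply: measurable_exists => [|s]; first exact: countableP.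
  apply: measurable_forall => [|u]; first exact: countableP.
  by apply: measurable_impl => //; exact: measurable_const.
apply/seteqP; split => f /=.
  by move=> /finite_seqP[s Ps]; exists s => u Pu; have : [set` s] u by rewrite -Ps.
by move=> [s Ps]; apply: (sub_finite_set _ (finite_seq s)) => u /Ps.
Qed.

Lemma measurable_visited_io x : measurable [set f | visited_io config_choices f x].
Proof.
apply: measurableC; apply: (@measurable_finite_vertices
  (fun u f => tree f u /\ pos f u = x)) => u.
apply: measurable_conj; first exact: measurable_in_tree.
exact: measurable_snake.
Qed.

Definition some_site_io : set config :=
  [set f | exists x, visited_io config_choices f x].

Lemma measurable_some_site_io : measurable some_site_io.
Proof.
apply: measurable_exists => [|x]; first exact: countableP.
exact: measurable_visited_io.
Qed.

(** Words run towards the root, so the descendant of [v] with relative name [u] is [u ++ v]. *)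
Definition rebase_label (v : vertex) (x : zd d) (i : label) : label :=
  match i with
  | inl (inl u) => Off (u ++ v)
  | inl (inr n) => Spine (n + size v)
  | inr (u, y) => Step (u ++ v) (y + x)
  end.

Lemma rebase_label_inj v x : injective (rebase_label v x).
Proof.
have catI (u u' : vertex) : u ++ v = u' ++ v -> u = u'.
  move=> e; have sz : size u = size u'.
    by have := congr1 size e; rewrite !size_cat => /addIn.
  by move/eqP: e; rewrite eqseq_cat // => /andP[/eqP].
move=> [[u|n]|[u y]] [[u'|n']|[u' y']] //= [].
- by move=> /catI ->.
- by move=> /addIn ->.
- by move=> /catI -> /addIr ->.
Qed.

Definition rebase (v : vertex) (x : zd d) : config -> config :=
  @precompose mark label label (rebase_label v x).

Lemma spine_rebase f n x m :
  spn f (m + n) = spn (rebase (spn f n) x f) m ++ spn f n.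
Proof.
elim: m => //= m ->; congr (_ :: _).
by rewrite /rebase /precompose /= size_spine.
Qed.

Lemma offspring_rebase f n x u :
  off (rebase (spn f n) x f) u = off f (u ++ spn f n).
Proof.
rewrite /offspring size_cat size_spine (spine_rebase f n x).
by rewrite eqseq_cat ?size_spine // eqxx andbT /= /rebase /precompose /= size_spine.
Qed.

Lemma in_tree_rebase f n x u : tree f (spn f n) ->
  tree f (u ++ spn f n) = tree (rebase (spn f n) x f) u.
Proof.
by move=> fn; elim: u => //= j u ->; rewrite (offspring_rebase f n x).
Qed.

Lemma snake_rebase f v u :
  pos f (u ++ v) = pos (rebase v (pos f v) f) u + pos f v.
Proof.
elim: u => [|j u IHu] /=; first by rewrite add0r.
by rewrite IHu [in RHS]addrAC.
Qed.

(* The progeny of v computed as if no descendant of v were on the spine. *)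
Fixpoint progeny (f : config) (v u : vertex) : bool :=
  if u is j :: u' then progeny f v u' && (j < (f (Off (u' ++ v))).1.1)%N
  else true.

Lemma progeny_rebase f v u : progeny f v u = progeny (rebase v 0 f) [::] u.
Proof. by elim: u => //= j u ->; rewrite cats0. Qed.

Definition finite_progeny : set config :=
  [set f | finite_set [set u | progeny f [::] u]].

Lemma measurable_finite_progeny : measurable finite_progeny.
Proof.
apply: (@measurable_finite_vertices (fun u f => progeny f [::] u)).
elim=> [|j u IHu] /=; first exact: measurable_const.
rewrite (_ : mkset _ =
  [set f | progeny f [::] u /\ (j < (f (Off (u ++ [::]))).1.1)%N]); last first.
  by apply/seteqP; split => f /= /andP.
apply: (measurable_conj (P := fun f => progeny f [::] u)) => //.
exact: (@measurable_mark _ [set x | (j < x.1.1)%N]).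
Qed.

(** A set of full measure ([ae_good]) on which restarting is exact: the chosen spine lies in the
    tree, and whatever hangs off it is finite. *)
Definition good : set config :=
  [set f | (forall n, ((f (Spine n)).1.2 < (f (Spine n)).1.1)%N) /\
           (forall v, finite_progeny (rebase v 0 f))].

Lemma spine_in_tree f n : good f -> tree f (spn f n).
Proof.
move=> [fn _]; elim: n => //= n ->.
by rewrite /offspring size_spine eqxx fn.
Qed.

Lemma in_tree_cat f u v : tree f (u ++ v) -> tree f v.
Proof. by elim: u => //= j u IHu /andP[/IHu]. Qed.

(** The ancestor at generation [n.+1] differs from the spine vertex there, so no later ancestor is
    on the spine and every offspring number is read from an [Off] mark. *)
Lemma off_spine_progeny f j n u : j != (f (Spine n)).1.2 ->
  tree f (u ++ j :: spn f n) -> progeny f (j :: spn f n) u.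
Proof.
move=> jn; elim: u => //= i u IHu /andP[fu iu]; rewrite IHu //=.
move: iu; rewrite /offspring; case: eqP => // /eqP.
rewrite size_cat [size (_ :: _)]/= size_spine (spine_rebase f n.+1 0).
rewrite eqseq_cat ?size_spine //= => /andP[_]; rewrite eqseq_cons => /andP[].
by rewrite (negbTE jn).
Qed.

(* Outside the subtree of the n-th spine vertex there are only the earlier
   spine vertices and the finitely many finite bushes hanging off them. *)
Lemma finite_off_subtree f n : good f ->
  finite_set [set u | tree f u /\ ~ exists u', u = u' ++ spn f n].
Proof.
move=> gf; elim: n => [|n IHn].
  rewrite (_ : mkset _ = set0) // -subset0 => u [_ /=]; apply.
  by exists u; rewrite cats0.
pose bush j := [set u ++ j :: spn f n | u in
  [set u | progeny f (j :: spn f n) u]].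
apply: (@sub_finite_set _ _ ([set u | tree f u /\ ~ exists u', u = u' ++ spn f n]
   `|` ([set spn f n] `|` \bigcup_(j in `I_(off f (spn f n))) bush j))).
  move=> u [fu nu] /=.
  case: (pselect (exists u', u = u' ++ spn f n)) => [[u' uE]|]; last by left.
  (* The last letter [j] of [u'] is the rank of the child of [spn f n] through which [u]
     descends. *)
  right; case: (lastP u') uE => [|u'' j] uE; first by left; rewrite uE.
  rewrite cat_rcons in uE; right; exists j.
    by move: fu; rewrite uE => /in_tree_cat /= /andP[].
  exists u'' => //=; apply: off_spine_progeny; last by rewrite -uE.
  by apply/eqP => jE; apply: nu; exists u''; rewrite uE /= jE.
rewrite !finite_setU; split=> //; split; first exact: (finite_set1 (spn f n)).
apply: bigcup_finite; first exact: finite_II.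
move=> j _; apply: finite_image; case: gf => _ /(_ (j :: spn f n)).
rewrite /finite_progeny /=; apply: sub_finite_set => u /=.
by rewrite -progeny_rebase.
Qed.

(** Appending [spn f n] matches the visits of the restarted snake with the visits inside the
    subtree; by [finite_off_subtree] only finitely many others exist. *)
Lemma visited_io_rebase f n x : good f ->
  visited_io config_choices f x <->
  visited_io config_choices (rebase (spn f n) (pos f (spn f n)) f)
    (x - pos f (spn f n)).
Proof.
move=> gf; set g := rebase _ _ f; set v := spn f n.
have fv := spine_in_tree n gf.
have treeE u : tree f (u ++ v) = tree g u by exact: in_tree_rebase.
have posE u : pos f (u ++ v) = pos g u + pos f v by exact: snake_rebase.
rewrite /visited_io.
suff -> : finite_set (visits config_choices f x) =
    finite_set (visits config_choices g (x - pos f v)) by [].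
apply/propext; split=> fin.
  apply: (@sub_finite_set _ _
    [set take (size u - n) u | u in visits config_choices f x]); last exact: finite_image.
  move=> u [/= gu ux]; exists (u ++ v).
    by split; rewrite ?treeE // posE ux subrK.
  by rewrite size_cat size_spine addnK take_size_cat.
apply: (@sub_finite_set _ _ ([set u | tree f u /\ ~ exists u', u = u' ++ v] `|`
    [set u ++ v | u in visits config_choices g (x - pos f v)])).
  move=> u [/= fu ux]; case: (pselect (exists u', u = u' ++ v)) => [[u' uE]|].
    right; exists u' => //; rewrite uE in fu ux; split; first by rewrite -treeE.
    by rewrite -ux posE addrK.
  by left.
rewrite finite_setU; split; first exact: finite_off_subtree.
exact: finite_image.
Qed.

(** Quantifying over the site absorbs the translation of the target. Visits to one fixed site would
    not be invariant in this way. *)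
Lemma some_site_io_rebase f n : good f -> some_site_io f <->
  some_site_io (rebase (spn f n) (pos f (spn f n)) f).
Proof.
move=> gf; split=> [[x /(visited_io_rebase n x gf) gx]|[x gx]].
  by exists (x - pos f (spn f n)).
exists (x + pos f (spn f n)).
by apply/(visited_io_rebase n _ gf); rewrite addrK.
Qed.

End CanonicalChoices.

(** * The law of the marks, and its derivation from the quenched law *)

Section SnakeLaw.
Context (R : realType) (d : nat) (q : nat -> R).
Implicit Type w : env R d.

(** All labels share one type of marks; the components that a label does not use must be 0. *)
Definition proper_mark (i : label d) (t : mark d) : bool :=
  match i with
  | inl (inl _) => (t.1.2 == 0%N) && (t.2 == 0)
  | inl (inr _) => t.2 == 0
  | inr _ => (t.1.1 == 0%N) && (t.1.2 == 0%N)
  end.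

Definition weight w (i : label d) (t : mark d) : R :=
  match i with
  | inl (inl _) => q t.1.1
  | inl (inr _) => (t.1.1%:R * q t.1.1) *
                   (if (t.1.2 < t.1.1)%N then (t.1.1%:R)^-1 else 0)
  | inr (_, y) => trans w y (y + t.2)
  end.

Definition law w (i : label d) (t : mark d) : R :=
  if proper_mark i t then weight w i t else 0.

Lemma env_pi_shift w x y : env_pi (env_shift x w) y = env_pi w (y + x).
Proof.
rewrite /env_pi [RHS](@reindex_esum _ _ _ setT setT (fun z => z + x)) //.
split => //; first by move=> z z' _ _ /addIr.
by move=> z _; exists (z - x) => //; rewrite subrK.
Qed.

Lemma trans_shift w x y z :
  trans (env_shift x w) y z = trans w (y + x) (z + x).
Proof. by rewrite /trans env_pi_shift. Qed.

Lemma law_rebase w v x i : law w (rebase_label v x i) = law (env_shift x w) i.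
Proof.
apply/funext => t; rewrite /law; case: i => [[u|n]|[u y]] //=.
by rewrite trans_shift addrAC.
Qed.

Lemma law_ge0 w i t : (forall k, 0 <= q k) -> (forall x y, 0 <= w x y) ->
  0 <= law w i t.
Proof.
move=> q0 w0; rewrite /law; case: ifP => // _.
case: i => [[u|n]|[u y]] /=; first exact: q0.
  by rewrite !mulr_ge0 //; case: ifP; rewrite // invr_ge0.
rewrite /trans divr_ge0 // fine_ge0 //; apply: esum_ge0 => *.
by rewrite lee_fin.
Qed.

Context (disp : measure_display) (Om : measurableType disp).
Variable xi : choices d Om.

Definition to_config (o : Om) : config d :=
  fun i => match i with
  | inl (inl u) => (off_spine xi u o, 0%N, 0)
  | inl (inr n) => (on_spine xi n o, next_spine xi n o, 0)
  | inr (u, y) => (0%N, 0%N, step xi u y o - y)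
  end.

Lemma measurable_to_config : measurable_fun setT to_config.
Proof.
apply: measurable_to_conf => -[[u|n]|[u y]] [[a b] z] /=.
- apply: (measurable_discrete [set k | (k, 0%N, 0) = (a, b, z)]).
    exact: countableP.
  exact: measurable_off_spine.
- apply: (measurable_bind (X := on_spine xi n)
    (P := fun k o => (k, next_spine xi n o, 0) = (a, b, z))).
  + exact: countableP.
  + exact: measurable_on_spine.
  + move=> k; apply: (measurable_discrete [set l | (k, l, 0) = (a, b, z)]).
      exact: countableP.
    exact: measurable_next_spine.
- apply: (measurable_discrete [set x | (0%N, 0%N, x - y) = (a, b, z)]).
    exact: countableP.
  exact: measurable_step.
Qed.

Lemma spine_to_config o n : spine xi o n = spine (config_choices d) (to_config o) n.
Proof. by elim: n => //= n ->. Qed.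

Lemma in_tree_to_config o u :
  in_tree xi o u = in_tree (config_choices d) (to_config o) u.
Proof.
by elim: u => //= j u ->; rewrite /offspring spine_to_config.
Qed.

Lemma snake_to_config o u :
  snake xi o u = snake (config_choices d) (to_config o) u.
Proof. by elim: u => //= j u ->; rewrite addrC subrK. Qed.

Lemma visited_io_to_config o x :
  visited_io xi o x = visited_io (config_choices d) (to_config o) x.
Proof.
rewrite /visited_io; congr (~ finite_set _); apply/seteqP.
by split=> u; rewrite /visits /= in_tree_to_config snake_to_config.
Qed.

Lemma to_config_proper o i : proper_mark i (to_config o i).
Proof. by case: i => [[u|n]|[u y]] /=; rewrite !eqxx. Qed.

(** The quenched law prescribes spine marks only in complete initial blocks. A general cylinder is
    therefore enlarged by the missing spine labels, which are then summed out one at a time by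
    [product_law_marginal]. *)
Lemma quenched_product_law w (mu : {measure set Om -> \bar R}) :
  (forall k, 0 <= q k) -> (forall x y, 0 <= w x y) ->
  quenched_law q w xi mu ->
  product_law (law w) (image_measure mu measurable_to_config).
Proof.
move=> q0 w0 hmu.
set nu := image_measure _ _.
have full U n V (a : label d -> mark d) : uniq U -> uniq V ->
    let s := map (@Off d) U ++ map (@Spine d) (iota 0 n) ++
             map (fun v => Step v.1 v.2) V in
    nu (cylinder s a) = (\prod_(i <- s) law w i (a i))%:E.
  move=> uU uV s.
  (* If some prescribed mark is improper both sides vanish, as [to_config] produces proper marks
     only. *)
  have [pa|/allPn[i is_ npa]] := boolP (all (fun i => proper_mark i (a i)) s); last first.
    rewrite /nu /image_measure /= /pushforward.
    rewrite (_ : _ @^-1` _ = set0); last first.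
      rewrite -subset0 => o /= /(_ i is_) ai; move: npa.
      by rewrite -ai to_config_proper.
    by rewrite measure0 (big_rem i) //= /law (negbTE npa) mul0r.
  transitivity (\prod_(i <- s) weight w i (a i))%:E; last first.
    rewrite big_seq [in RHS]big_seq; congr (_%:E); apply: eq_bigr => i is_.
    by rewrite /law (allP pa _ is_).
  have := hmu U n V (fun u => (a (Off d u)).1.1) (fun i => (a (Spine d i)).1.1)
    (fun i => (a (Spine d i)).1.2) (fun v => v.2 + (a (Step v.1 v.2)).2) uU uV.
  rewrite /s !big_cat /= !big_map -mulrA.
  rewrite -(big_mkord xpredT (fun i => (a (Spine d i)).1.1%:R *
    q (a (Spine d i)).1.1 * (if ((a (Spine d i)).1.2 < (a (Spine d i)).1.1)%N
    then ((a (Spine d i)).1.1%:R)^-1 else 0))) /index_iota subn0.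
  have -> : \prod_(v <- V) weight w (Step v.1 v.2) (a (Step v.1 v.2)) =
      \prod_(v <- V) trans w v.2 (v.2 + (a (Step v.1 v.2)).2) by [].
  move=> <-; rewrite /nu /image_measure /= /pushforward; congr (mu _).
  have eqm (t t' : mark d) : t.1.1 = t'.1.1 -> t.1.2 = t'.1.2 -> t.2 = t'.2 -> t = t'.
    by case: t t' => [[? ?] ?] [[? ?] ?] /= -> -> ->.
  apply/seteqP; split => o /= H.
    split=> [u uU'|i ilt|v vV].
    - have /H <- // : Off d u \in s by rewrite mem_cat map_f.
    - have /H <- // : Spine d i \in s.
      by rewrite !mem_cat map_f ?orbT // mem_iota.
    - have /H <- : Step v.1 v.2 \in s.
        by rewrite !mem_cat (map_f (fun v => Step v.1 v.2)) ?orbT.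
      by rewrite /= addrC subrK.
  case: H => H1 H2 H3 i is_.
  have := allP pa _ is_.
  move: is_; rewrite !mem_cat => /or3P[/mapP[u uU' ->]|/mapP[k + ->]|/mapP[v vV ->]] /=.
  - by move=> /andP[/eqP ? /eqP ?]; apply: eqm => //=; exact: H1.
  - by rewrite mem_iota /= add0n => /H2[? ?] /eqP ?; apply: eqm.
  - move=> /andP[/eqP ? /eqP ?]; apply: eqm => //=.
    by rewrite (H3 _ vV) addrC addKr.
have nuT : nu setT = 1%E.
  have := full [::] 0%N [::] point isT isT.
  by rewrite /= cylinder0 big_nil.
(* Total mass one of the spine mark law is read off [nu] at [Spine 0]; the law is the same for every
   [k]. *)
have sum1 k : (\esum_(t in [set: mark d]) (law w (Spine d k) t)%:E = 1)%E.
  rewrite -nuT (total_probability nu (@countable_mark d)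
    (@measurable_coordinate _ _ (Spine d 0))) //.
  apply: eq_esum => t _; rewrite setTI.
  have := full [::] 1%N [::] (fun=> t) isT isT.
  by rewrite /= cylinder_cons cylinder0 setIT big_seq1 => ->.
move=> s a us.
pose U := pmap (fun i : label d => if i is inl (inl u) then Some u else None) s.
pose V := pmap (fun i : label d => if i is inr v then Some v else None) s.
have mU u : (u \in U) = (Off d u \in s).
  rewrite mem_pmap; apply/mapP/idP => [[[[u'|//]|//] ? [->//]]|us'].
  by exists (Off d u).
have mV v : (v \in V) = (Step v.1 v.2 \in s).
  rewrite mem_pmap; apply/mapP/idP => [[[//|[u' y']] ? [->//]]|vs].
  by exists (Step v.1 v.2) => //; case: (v).
have uU : uniq U.
  by apply: (pmap_uniq (g := @Off d)) us => -[[]|].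
have uV : uniq V.
  by apply: (pmap_uniq (g := fun v => Step v.1 v.2)) us => -[[]|[]].
have [n nP] : exists n, forall k, Spine d k \in s -> (k < n)%N.
  exists (\max_(i <- s) (if i is inl (inr k) then k else 0)).+1 => k ks.
  by rewrite ltnS (big_rem _ ks) /= leq_maxl.
(* The spine labels below [n] that [s] lacks; [m ++ s] is, up to order, of the form treated by
   [full]. *)
pose m := [seq Spine d k | k <- iota 0 n & Spine d k \notin s].
have um : uniq (m ++ s).
  rewrite cat_uniq us andbT; apply/andP; split.
    rewrite map_inj_uniq; last by move=> ? ? [].
    by rewrite filter_uniq ?iota_uniq.
  apply/hasPn => i is_; apply/negP => /mapP[k + ik].
  by rewrite mem_filter -ik is_.
have perm : perm_eq (m ++ s) (map (@Off d) U ++ map (@Spine d) (iota 0 n) ++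
    map (fun v => Step v.1 v.2) V).
  apply: uniq_perm => //.
    rewrite !cat_uniq !map_inj_uniq ?uU ?uV ?iota_uniq /= ?andbT.
    - apply/andP; split; apply/hasPn => i.
        by rewrite mem_cat => /orP[] /mapP[? _ ->]; apply/mapP => -[].
      by move=> /mapP[? _ ->]; apply/mapP => -[].
    - by move=> [? ?] [? ?] [-> ->].
    - by move=> ? ? [].
    - by move=> ? ? [].
  move=> i; rewrite !mem_cat; case: i => [[u|k]|[u y]].
  - rewrite (_ : _ \in m = false); last by apply/mapP => -[].
    rewrite (_ : _ \in map (@Spine d) _ = false); last by apply/mapP => -[].
    rewrite (_ : _ \in map _ V = false); last by apply/mapP => -[].
    by rewrite !orbF /= mem_map ?mU // => ? ? [].
  - rewrite (_ : _ \in map (@Off d) _ = false); last by apply/mapP => -[].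
    rewrite (_ : _ \in map _ V = false); last by apply/mapP => -[].
    rewrite !orbF /=; have injS : injective (@Spine d) by move=> ? ? [].
    rewrite !(mem_map injS) mem_filter mem_iota /= add0n.
    case: (boolP (inl (inr k) \in s)) => [ks|ks]; first by rewrite orbT (nP _ ks).
    by rewrite orbF.
  - rewrite (_ : _ \in m = false); last by apply/mapP => -[].
    rewrite (_ : _ \in map (@Off d) _ = false); last by apply/mapP => -[].
    rewrite (_ : _ \in map (@Spine d) _ = false); last by apply/mapP => -[].
    have injS : injective (fun v : vertex * zd d => Step v.1 v.2).
      by move=> [? ?] [? ?] [-> ->].
    by have := mem_map injS V (u, y); rewrite mV /= => ->.
have all_ms b : nu (cylinder (m ++ s) b) = (\prod_(i <- m ++ s) law w i (b i))%:E.
  rewrite (perm_big _ perm) -full //; congr (nu _).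
  apply/seteqP; split => f /= H i.
    by rewrite -(perm_mem perm); exact: H.
  by rewrite (perm_mem perm); exact: H.
have : all (fun i : label d => if i is inl (inr _) then true else false) m.
  by apply/allP => i /mapP[k _ ->].
elim: (m) um all_ms => [_ all_ms _|i m' IHm um all_ms]; first exact: all_ms.
case: i um all_ms => [[//|k]|//] um all_ms /= am.
move: um => /= /andP[km um]; apply: (IHm um) => // b.
apply: (product_law_marginal (i := Spine d k)) => //; first exact: countable_mark.
by move=> t; exact: law_ge0.
Qed.

End SnakeLaw.

(** * Extinction of critical trees *)

Section AlmostEverywhere.
Context (disp : measure_display) (Om : measurableType disp) (R : realType)
  (mu : {measure set Om -> \bar R}).

Lemma ae_forall_countable (K : countType) (P : K -> Om -> Prop) :
  (forall k, {ae mu, forall o, P k o}) -> {ae mu, forall o k, P k o}.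
Proof.
move=> aeP.
have : \forall o \ae mu, forall n : nat,
    if unpickle n is Some k then P k o else True.
  apply: ae_foralln => n; case: (unpickle n) => [k|]; first exact: aeP.
  exact: aeW.
by apply: filterS => o Po k; have := Po (pickle k); rewrite pickleK.
Qed.

Lemma le_measure_ae (A B : set Om) : measurable A -> measurable B ->
  {ae mu, forall o, A o -> B o} -> (mu A <= mu B)%E.
Proof.
move=> mA mB [N [mN N0 AB]].
apply: (@le_trans _ _ (mu (B `|` N))).
  apply: le_measure; rewrite ?inE //; first exact: measurableU.
  move=> o Ao; case: (pselect (B o)) => [|nB]; first by left.
  by right; apply: AB => /= /(_ Ao).
have -> : mu B = (mu B + mu N)%E by rewrite N0 adde0.
exact: measureU2.
Qed.

Lemma eq_measure_ae (A B : set Om) : measurable A -> measurable B ->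
  {ae mu, forall o, A o <-> B o} -> mu A = mu B.
Proof.
move=> mA mB AB; apply/eqP; rewrite eq_le !le_measure_ae //.
  by apply: filterS AB => o [].
by apply: filterS AB => o [].
Qed.

Lemma ae_setC0 (A : set Om) : measurable A -> mu (~` A) = 0%E ->
  {ae mu, forall o, A o}.
Proof. by move=> mA A0; exists (~` A); split=> //; exact: measurableC. Qed.

End AlmostEverywhere.

Lemma esum_single (R : realType) (T : choiceType) (D : set T) (a : T -> \bar R) t0 :
  D t0 -> (0 <= a t0)%E -> (forall t, D t -> t <> t0 -> a t = 0%E) ->
  (\esum_(t in D) a t = a t0)%E.
Proof.
move=> Dt0 at0 a0; rewrite (esumID [set t0]); last first.
  by move=> t Dt; have [->//|/eqP tt0] := eqVneq t t0; rewrite a0.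
rewrite (_ : D `&` [set t0] = [set t0]); last first.
  by apply/seteqP; split => t /= => [[]|->].
by rewrite esum_set1 // esum1 ?adde0 // => t [/a0].
Qed.

Section CriticalOffspring.
Context (R : realType) (q : nat -> R).
Hypothesis hq : critical_offspring q.

Lemma offspring_ge0 k : 0 <= q k.
Proof. by case: hq. Qed.

(** The terms of the variance series vanish at [k = 0] and [k = 1], so its positivity must come from
    some [k >= 2]. *)
Lemma critical_branching : exists2 k, (2 <= k)%N & 0 < q k.
Proof.
case: hq => q0 _ _ _; apply: contraPP => /forall2NP nk.
apply/negP; rewrite -leNgt eseries0 // => k _ _.
case: k => [|[|k]]; rewrite ?mul0r ?subrr ?mulr0 ?mul0r //.
have [//|/negP] := nk k.+2; rewrite -leNgt => qk.
suff -> : q k.+2 = 0 by rewrite mulr0.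
by apply/eqP; rewrite eq_le qk q0.
Qed.

(** Bernoulli's inequality; passing from [k] to [k.+1] adds [(1 - s) * (1 - s ^+ k)], which is
    nonnegative. *)
Lemma bernoulli_gap (s : R) k : 0 <= s <= 1 ->
  0 <= s ^+ k + k%:R * (1 - s) - 1.
Proof.
move=> /andP[s0 s1]; elim: k => [|k IHk]; first by rewrite expr0 mul0r addr0 subrr.
have -> : s ^+ k.+1 + k.+1%:R * (1 - s) - 1 =
    (s ^+ k + k%:R * (1 - s) - 1) + (1 - s) * (1 - s ^+ k).
  by rewrite exprS -natr1; ring.
by rewrite addr_ge0 // mulr_ge0 // subr_ge0 // exprn_ile1.
Qed.

(** At [k = 2] the gap is [(1 - s) ^+ 2], and from there on it does not decrease. *)
Lemma bernoulli_gap_gt0 (s : R) k : 0 <= s < 1 -> (2 <= k)%N ->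
  0 < s ^+ k + k%:R * (1 - s) - 1.
Proof.
move=> /andP[s0 s1]; case: k => [//|[//|k]] _.
elim: k => [|k IHk].
  have -> : s ^+ 2 + 2%:R * (1 - s) - 1 = (1 - s) ^+ 2 by ring.
  by rewrite exprn_gt0 // subr_gt0.
have -> : s ^+ k.+3 + k.+3%:R * (1 - s) - 1 =
    (s ^+ k.+2 + k.+2%:R * (1 - s) - 1) + (1 - s) * (1 - s ^+ k.+2).
  by rewrite exprS -(natr1 k.+2); ring.
by rewrite ltr_wpDr // mulr_ge0 // subr_ge0 ?exprn_ile1 // ltW.
Qed.

(* By Bernoulli's inequality s^k >= 1 - k (1 - s); averaging against q,
   which has mean 1, a fixed point s forces equality for every k with q_k > 0. *)
Lemma critical_fixpoint (s : R) : 0 <= s <= 1 ->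
  (\sum_(0 <= k <oo) (q k * s ^+ k)%:E = s%:E)%E -> s = 1.
Proof.
move=> s01 fixs; have /andP[s0 s1] := s01; apply/eqP; rewrite eq_le s1 /= leNgt.
apply/negP => s_lt1.
case: hq => q0 q1 qmean _ _.
have [k0 k02 qk0] := critical_branching.
pose b k := s ^+ k + k%:R * (1 - s) - 1.
have b0 k : 0 <= b k by exact: bernoulli_gap.
(* One series is evaluated twice: the fixed point equation and mean one give [s + (1 - s) = 1],
   while total mass one gives 1 plus the series of gaps, which therefore vanishes. *)
have e1 : (\sum_(0 <= k <oo) (q k * (s ^+ k + k%:R * (1 - s)))%:E = 1)%E.
  transitivity (\sum_(0 <= k <oo) ((q k * s ^+ k)%:E + (1 - s)%:E * (k%:R * q k)%:E))%E.
    by apply: eq_eseriesr => k _; rewrite -EFinM -EFinD; congr (_%:E); ring.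
  rewrite nneseriesD; last 2 first.
  - by move=> *; rewrite lee_fin mulr_ge0 // exprn_ge0.
  - by move=> *; rewrite mule_ge0 // lee_fin ?mulr_ge0 // subr_ge0.
  rewrite fixs nneseriesZl; last by move=> *; rewrite lee_fin mulr_ge0.
  by rewrite qmean mule1 -EFinD addrC subrK.
have e2 : (\sum_(0 <= k <oo) (q k * (s ^+ k + k%:R * (1 - s)))%:E =
    1 + \sum_(0 <= k <oo) (q k * b k)%:E)%E.
  rewrite -q1 -nneseriesD; last 2 first.
  - by move=> *; rewrite lee_fin.
  - by move=> *; rewrite lee_fin mulr_ge0.
  by apply: eq_eseriesr => k _; rewrite -EFinD /b; congr (_%:E); ring.
have : (\sum_(0 <= k <oo) (q k * b k)%:E = 0)%E.
  move: e2; rewrite e1.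
  case: (\sum_(0 <= k <oo) (q k * b k)%:E)%E => //= r [].
  by rewrite -[LHS]addr0 => /addrI <-.
have bk0 : (0 < (q k0 * b k0)%:E)%E.
  by rewrite lte_fin mulr_gt0 // bernoulli_gap_gt0 // s0.
rewrite (nneseriesD1 (n := k0)) //; last by move=> *; rewrite lee_fin mulr_ge0.
move/eqP; rewrite gt_eqF // (lt_le_trans bk0) // leeDl //.
by apply: nneseries_ge0 => *; rewrite lee_fin mulr_ge0.
Qed.

End CriticalOffspring.

Section Extinction.
Context (R : realType) (d : nat) (q : nat -> R).
Hypothesis hq : critical_offspring q.
Implicit Types (w : env R d) (mu : {measure set (config d) -> \bar R}).

Lemma measurable_rebase v x : measurable_fun setT (@rebase d v x).
Proof. exact: measurable_precompose. Qed.

Lemma measurable_rebase_preimage v x (A : set (config d)) :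
  measurable A -> measurable (rebase v x @^-1` A).
Proof.
by move=> mA; rewrite -[X in measurable X]setTI; exact: measurable_rebase.
Qed.

Lemma product_law_rebase w mu v x : product_law (law q w) mu ->
  product_law (law q (env_shift x w)) (image_measure mu (measurable_rebase v x)).
Proof.
move=> pmu s a us.
rewrite (product_law_precompose (@rebase_label_inj d v x) pmu) //.
by congr (_%:E); apply: eq_bigr => i _; rewrite law_rebase.
Qed.

Lemma env_shift0 w : env_shift 0 w = w.
Proof. by apply/funext => x; apply/funext => y; rewrite /env_shift !addr0. Qed.

Lemma rebase0_measure w mu v A : product_law (law q w) mu -> measurable A ->
  mu (rebase v 0 @^-1` A) = mu A.
Proof.
move=> pmu mA; have := product_law_rebase v 0 pmu; rewrite env_shift0 => pmu'.
exact: (product_law_unique pmu' pmu mA).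
Qed.

Lemma offspring_marginal w mu u k : product_law (law q w) mu ->
  mu [set f | (f (Off d u)).1.1 = k] = (q k)%:E.
Proof.
move=> pmu.
rewrite (product_law_coordinate _ [set t : mark d | t.1.1 = k] (@countable_mark d) pmu).
rewrite (esum_single (t0 := (k, 0%N, 0))) //=.
- by rewrite /law /= !eqxx.
- by rewrite /law /= !eqxx lee_fin; exact: offspring_ge0.
move=> [[a b] z] /= -> ne; rewrite /law /=; case: eqP => //= b0; case: eqP => //= z0.
by case: ne; rewrite b0 z0.
Qed.

Lemma spine_marginal w mu n : product_law (law q w) mu ->
  {ae mu, forall f, ((f (Spine d n)).1.2 < (f (Spine d n)).1.1)%N}.
Proof.
move=> pmu; apply: ae_setC0.
  exact: (@measurable_mark d _ [set t | (t.1.2 < t.1.1)%N]).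
rewrite (product_law_coordinate _ [set t : mark d | ~ (t.1.2 < t.1.1)%N]
  (@countable_mark d) pmu).
apply: esum1 => -[[a b] z] /= /negP /negbTE ba.
by rewrite /law /= ba mulr0 if_same.
Qed.

(** [progeny] unfolds a word from its youngest generation; branching at the root needs the other
    end. *)
Lemma progeny_cat (f : config d) v j u :
  progeny f v (u ++ [:: j]) = (j < (f (Off d v)).1.1)%N && progeny f (j :: v) u.
Proof.
elim: u => [|i u IHu] /=; first by rewrite andbT.
by rewrite IHu -andbA -catA.
Qed.

Lemma finite_progeny_children (f : config d) :
  finite_progeny f <->
  forall j, (j < (f (Off d [::])).1.1)%N -> finite_progeny (rebase [:: j] 0 f).
Proof.
split=> [finf j jf|finf].
  apply: (@sub_finite_set _ _ [set take (size u).-1 u | u in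
    [set u | progeny f [::] u]]); last exact: finite_image.
  move=> u /= fu; exists (u ++ [:: j]).
    by rewrite /= progeny_cat jf progeny_rebase.
  by rewrite size_cat addn1 /= take_size_cat.
apply: (@sub_finite_set _ _ ([set [::]] `|` \bigcup_(j in `I_((f (Off d [::])).1.1))
  [set u ++ [:: j] | u in [set u | progeny (rebase [:: j] 0 f) [::] u]])).
  move=> u /=; case: (lastP u) => [|u' j]; first by left.
  rewrite -cats1 progeny_cat => /andP[jf fu]; right; exists j => //.
  by exists u' => //=; rewrite -progeny_rebase.
rewrite finite_setU; split; first exact: (finite_set1 [::]).
apply: bigcup_finite; first exact: finite_II.
by move=> j jf; apply: finite_image; exact: finf.
Qed.

Definition descendant_labels (v : vertex) : set (label d) :=
  [set i | exists u, i = Off d (u ++ v)].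

Lemma finite_progeny_depends v :
  depends_on (descendant_labels v) (rebase v 0 @^-1` @finite_progeny d).
Proof.
move=> f g fg; rewrite /preimage /finite_progeny /=; congr finite_set.
apply/seteqP.
have E u : progeny (rebase v 0 f) [::] u = progeny (rebase v 0 g) [::] u.
  elim: u => //= j u ->; congr (_ && (_ < _.1.1)%N).
  by rewrite /rebase /precompose /= cats0; apply: fg; exists u.
by split=> u /=; rewrite E.
Qed.

(** The extinction probability [s] is a fixed point of the generating function: the progeny is
    finite when that of each child is, and the number of children and the subtrees of distinct
    children rest on disjoint labels. *)
Lemma finite_progeny_full w mu : product_law (law q w) mu ->
  mu (@finite_progeny d) = 1%E.
Proof.
move=> pmu; have mfin := @measurable_finite_progeny d.
have fin_num := product_law_fin pmu mfin.
set s := fine (mu (@finite_progeny d)).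
have sE : mu (@finite_progeny d) = s%:E by rewrite fineK.
have s01 : 0 <= s <= 1.
  by rewrite -!lee_fin -sE measure_ge0 (product_law_le1 pmu).
rewrite sE; congr (_%:E); apply: (critical_fixpoint hq s01).
pose X (f : config d) := (f (Off d [::])).1.1.
have mX : discretely_measurable X.
  by move=> k; exact: (@measurable_mark d _ [set t | t.1.1 = k]).
(* The number [k] of children and the number [m] of subtrees examined are kept apart, so that
   induction on [m] adds one independent factor [s] at a time; [m = k] at the end. *)
pose kids k m := [set f : config d | X f = k /\
  forall j, (j < m)%N -> finite_progeny (rebase [:: j] 0 f)].
have mkids k m : measurable (kids k m).
  apply: measurable_conj; first exact: mX.
  apply: measurable_forall => [|j]; first exact: countableP.
  apply: measurable_impl; first exact: measurable_const.
  exact: measurable_rebase_preimage.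
have kidsE k m : mu (kids k m) = (q k * s ^+ m)%:E.
  elim: m => [|m IHm].
    rewrite expr0 mulr1 -(offspring_marginal [::] k pmu); congr (mu _).
    by apply/seteqP; split => f /= => [[]|].
  have -> : kids k m.+1 = kids k m `&` (rebase [:: m] 0 @^-1` @finite_progeny d).
    apply/seteqP; split => f /=.
      move=> [fk H]; split; last exact: H.
      by split=> // j jm; apply: H; exact: ltnW.
    move=> [[fk H] Hm]; split=> // j; rewrite ltnS leq_eqVlt => /predU1P[->//|].
    exact: H.
  pose D : set (label d) := [set i | i = Off d [::] \/
    exists2 j, (j < m)%N & descendant_labels [:: j] i].
  rewrite (@product_law_indep _ _ _ _ _ D (descendant_labels [:: m]) _ _ pmu) //.
  - by rewrite IHm (rebase0_measure _ pmu) // sE -EFinM exprSr mulrA.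
  - move=> i [->|[j jm [u ->]]] [u'].
      by move=> [] /(congr1 size); rewrite size_cat addn1.
    move=> []; rewrite !cats1 => /rcons_inj[_ jE].
    by rewrite jE ltnn in jm.
  - move=> f g fg [fk H]; split.
      by rewrite -fk /X fg //; left.
    move=> j jm; apply: (finite_progeny_depends _ (H j jm)) => i ji.
    by apply: fg; right; exists j.
  - exact: finite_progeny_depends.
  - exact: measurable_rebase_preimage.
rewrite -sE (total_probability mu _ mX mfin); last exact: countableP.
rewrite nneseries_esumT; last first.
  move=> k; rewrite lee_fin mulr_ge0 ?(offspring_ge0 hq) // exprn_ge0 //.
  by case/andP: s01.
apply: eq_esum => k _; rewrite -kidsE; congr (mu _); apply/seteqP; split => f /=.
  move=> [fk H]; split=> //; apply/finite_progeny_children => j.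
  by rewrite -/(X f) fk; exact: H.
by move=> [/finite_progeny_children H fk]; split=> // j jk; apply: H; rewrite -/(X f) fk.
Qed.

Lemma ae_good w mu : product_law (law q w) mu -> {ae mu, forall f, good f}.
Proof.
move=> pmu.
have H1 := ae_forall_countable (fun n => spine_marginal n pmu).
have H2 : {ae mu, forall f v, finite_progeny (rebase v 0 f)}.
  apply: ae_forall_countable => v.
  have mfin := @measurable_finite_progeny d.
  apply: ae_setC0; first exact: measurable_rebase_preimage.
  rewrite (product_law_setC pmu); last exact: measurable_rebase_preimage.
  by rewrite (rebase0_measure _ pmu) // (finite_progeny_full pmu) subee.
by apply: filterS2 H1 H2 => f; split.
Qed.

End Extinction.

(** * The Markov property along the spine *)

Section SpineMarkov.
Context (R : realType) (d : nat).
Local Notation spn := (spine (config_choices d)).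
Local Notation tree := (in_tree (config_choices d)).
Local Notation pos := (snake (config_choices d)).
Implicit Types (f g : config d).

(** What determines the tree and the positions up to generation [n]. Offspring numbers describe the
    next generation, hence the strict bound; steps are indexed by the vertex being placed, hence the
    weak one. *)
Definition past (n : nat) : set (label d) :=
  [set i | match i with
  | inl (inl u) => (size u < n)%N
  | inl (inr k) => (k < n)%N
  | inr (u, _) => (size u <= n)%N
  end].

(* The mark of Step [::] y places the root, and is never used. *)
Definition nonroot : set (label d) :=
  [set i | if i is inr (u, _) then u != [::] else true].

Lemma spine_agree n f g :
  (forall i, past n i -> nonroot i -> f i = g i) -> spn f n = spn g n.
Proof.
elim: n => //= n IHn fg; rewrite fg //=; congr (_ :: _); apply: IHn => i pi.
apply: fg; move: pi; case: i => [[u|k]|[u y]] /=.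
- exact: ltnW.
- exact: ltnW.
- exact: leqW.
Qed.

Lemma past_le n m : (n <= m)%N -> past n `<=` past m.
Proof.
move=> nm [[u|k]|[u y]] /=.
- by move=> un; exact: leq_trans un nm.
- by move=> un; exact: leq_trans un nm.
- by move=> un; exact: leq_trans un nm.
Qed.

Lemma in_tree_agree u f g :
  (forall i, past (size u) i -> nonroot i -> f i = g i) -> tree f u = tree g u.
Proof.
elim: u => //= j u IHu fg; rewrite IHu; last first.
  by move=> i /(past_le (leqnSn _)); exact: fg.
congr (_ && (_ < _)%N); rewrite /offspring (@spine_agree (size u) f g).
  by case: eqP => _; rewrite /= fg //=.
by move=> i /(past_le (leqnSn _)); exact: fg.
Qed.

Lemma snake_agree u f g :
  (forall i, past (size u) i -> nonroot i -> f i = g i) -> pos f u = pos g u.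
Proof.
elim: u => //= j u IHu fg; rewrite IHu; last first.
  by move=> i /(past_le (leqnSn _)); exact: fg.
by rewrite fg //=.
Qed.

Lemma some_site_io_depends : depends_on nonroot (@some_site_io d).
Proof.
move=> f g fg [x fx]; exists x; apply: contra_not fx; apply: sub_finite_set.
move=> u [/= fu ux]; split.
  by rewrite -(@in_tree_agree u f g) // => i _; exact: fg.
by rewrite -(@snake_agree u f g) // => i _; exact: fg.
Qed.

Lemma rebase_depends (D : set (label d)) A v x : depends_on D A ->
  depends_on (rebase_label v x @` D) (rebase v x @^-1` A).
Proof.
move=> dA f g fg; apply: dA => i Di; apply: fg; by exists i.
Qed.

(** The only labels that the past and the relabelled future could share are the [Step v y], images
    of root steps; [nonroot] excludes them. *)
Lemma past_future_disjoint v x i :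
  past (size v) i -> (rebase_label v x @` nonroot) i -> False.
Proof.
move=> pi [j nj ji]; move: pi; rewrite -ji; case: j nj {ji} => [[u|k]|[u y]] /= nj.
- by rewrite size_cat ltnNge leq_addl.
- by rewrite ltnNge leq_addl.
- by rewrite size_cat -[X in (_ <= X)%N]add0n leq_add2r leqn0 size_eq0 (negbTE nj).
Qed.

Context (q : nat -> R).
Hypothesis hq : critical_offspring q.
Variables (w : env R d) (mu : {measure set (config d) -> \bar R}).
Hypothesis pmu : product_law (law q w) mu.

Definition spine_position (n : nat) f : zd d := pos f (spn f n).

Lemma measurable_spine_position n :
  discretely_measurable (spine_position n).
Proof.
apply: (discretely_measurable_bind (X := fun f => spn f n)
  (Y := fun v f => pos f v)); first exact: countableP.
  exact: measurable_spine.
exact: measurable_snake.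
Qed.

Lemma spine_position_depends n x : depends_on (past n)
  [set f | spine_position n f = x].
Proof.
move=> f g fg /= <-; rewrite /spine_position.
rewrite -(@spine_agree n f g) => [|i pi _]; last exact: fg.
rewrite (@snake_agree _ f g) // size_spine => i pi _; exact: fg.
Qed.

Lemma spine_depends n v : depends_on (past n) [set f | spn f n = v].
Proof.
by move=> f g fg /= <-; rewrite (@spine_agree n f g) // => i pi _; exact: fg.
Qed.

(** Only the site of the restart matters, not the vertex: both sides come from product laws in the
    same shifted environment. *)
Lemma rebase_position_measure v x A : measurable A ->
  mu (rebase v x @^-1` A) = mu (rebase [::] x @^-1` A).
Proof.
move=> mA.
exact: (product_law_unique (product_law_rebase v x pmu)
  (product_law_rebase [::] x pmu) mA).
Qed.

(** For each value [v] of the spine vertex, the event agrees almost surely with its restart at [v],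
    which reads labels disjoint from [past n] and has a probability independent of [v]. *)
Lemma spine_markov n x A : measurable A -> depends_on (past n) A ->
  mu (A `&` [set f | spine_position n f = x] `&` @some_site_io d) =
  (mu (A `&` [set f | spine_position n f = x]) *
   mu (rebase [::] x @^-1` @some_site_io d))%E.
Proof.
move=> mA dA; set E := @some_site_io d.
have mE : measurable E by exact: measurable_some_site_io.
set B := A `&` _; set h := mu (rebase [::] x @^-1` E).
have mB : measurable B by apply: measurableI => //; exact: measurable_spine_position.
have dB : depends_on (past n) B.
  by apply: depends_onI => //; exact: spine_position_depends.
have mshE v : measurable (rebase v x @^-1` E) by exact: measurable_rebase_preimage.
have ctv : countable [set: vertex] by exact: countableP.
rewrite (total_probability mu ctv (@measurable_spine d n) (measurableI _ _ mB mE)).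
rewrite (total_probability mu ctv (@measurable_spine d n) mB).
rewrite muleC -esumZl; last 3 first.
- exact: measure_ge0.
- exact: product_law_fin pmu _.
- by move=> t; exact: measure_ge0.
(* Words of length other than [n] contribute 0 on both sides; for the others [past n] is
   [past (size v)], as disjointness requires. *)
apply: eq_esum => v _; have [vn|vn] := eqVneq (size v) n; last first.
  have -> C : C `&` [set f | spn f n = v] = set0.
    rewrite -subset0 => f /= [_ fv]; move: vn.
    by rewrite -fv size_spine eqxx.
  rewrite (_ : B `&` [set f | spn f n = v] = set0) ?measure0 ?mule0 //.
  rewrite -subset0 => f /= [_ fv]; move: vn.
  by rewrite -fv size_spine eqxx.
have mBv : measurable (B `&` [set f | spn f n = v]).
  by apply: measurableI => //; exact: measurable_spine.
transitivity (mu ((B `&` [set f | spn f n = v]) `&` (rebase v x @^-1` E))).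
  apply: eq_measure_ae.
  - apply: measurableI; first exact: measurableI.
    exact: measurable_spine.
  - exact: measurableI.
  apply: filterS (ae_good hq pmu) => f gf.
  split=> [[[[Af fx] Ef] fv]|[[[Af fx] fv] Ef]].
    split=> //; move/(some_site_io_rebase n gf): Ef.
    by rewrite /= -[pos _ _]/(spine_position n f) fx fv.
  split=> //; split=> //; apply/(some_site_io_rebase n gf).
  by rewrite -[pos _ _]/(spine_position n f) fx fv.
rewrite (@product_law_indep _ _ _ _ _ (past n) (rebase_label v x @` nonroot) _ _ pmu) //.
- by rewrite muleC; congr (_ * _)%E; exact: rebase_position_measure.
- by move=> i; rewrite -vn; exact: past_future_disjoint.
- by apply: depends_onI => //; exact: spine_depends.
- apply: rebase_depends; exact: some_site_io_depends.
Qed.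

Lemma cylinder_past (s : seq (label d)) (a : label d -> mark d) :
  exists n, depends_on (past n) (cylinder s a).
Proof.
pose lv (i : label d) : nat := match i with
  | inl (inl u) => (size u).+1 | inl (inr k) => k.+1 | inr (u, _) => size u end.
exists (\max_(i <- s) lv i)%N => f g fg /= fa i is_; rewrite -fa // fg //.
have : (lv i <= \max_(i <- s) lv i)%N by rewrite (big_rem _ is_) /= leq_maxl.
by case: i {is_} => [[u|k]|[u y]].
Qed.

(** The restriction of [mu] to the event and [mu] scaled by its probability agree on cylinders,
    hence everywhere; they are then evaluated at the event itself. For a cylinder, the Markov
    property is used at a generation beyond all its labels and summed over the spine positions. *)
Lemma some_site_io_01 :
  (forall x, mu (rebase [::] x @^-1` @some_site_io d) = mu (@some_site_io d)) ->
  mu (@some_site_io d) = (mu (@some_site_io d) * mu (@some_site_io d))%E.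
Proof.
set E := @some_site_io d => hE.
have mE : measurable E by exact: measurable_some_site_io.
have fin := product_law_fin pmu mE.
have r0 : (0 <= fine (mu E))%R by rewrite fine_ge0 // measure_ge0.
pose m2 := mscale (NngNum r0) mu.
have m2E A : m2 A = (mu E * mu A)%E by rewrite /m2 /mscale /= fineK.
have m1E A : mrestr mu mE A = mu (A `&` E) by [].
rewrite -m2E -{1}(setIid E) -m1E.
apply: (@conf_measure_unique _ _ _ (mrestr mu mE) m2) => //; last first.
  rewrite /= /mrestr setTI ltey_eq; apply/orP; left; exact: fin.
move=> s a _; apply: etrans (esym (m2E _)); rewrite /= /mrestr.
have [n pn] := cylinder_past s a; have mC := measurable_cylinder s a.
have ctx : countable [set: zd d] by exact: countableP.
rewrite (total_probability mu ctx (@measurable_spine_position n) (measurableI _ _ mC mE)).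
rewrite (total_probability mu ctx (@measurable_spine_position n) mC).
rewrite -esumZl ?measure_ge0 //; apply: eq_esum => x _.
by rewrite setIAC spine_markov // hE muleC.
Qed.

Lemma step_marginal u y z :
  (forall x y, 0 <= w x y) ->
  mu [set f | (f (Step u y)).2 = z] = (trans w y (y + z))%:E.
Proof.
move=> w0; rewrite (product_law_coordinate _ [set t : mark d | t.2 = z]
  (@countable_mark d) pmu).
rewrite (esum_single (t0 := (0%N, 0%N, z))) //=.
- by rewrite lee_fin law_ge0 //; exact: offspring_ge0.
- move=> [[a b] z'] /= -> ne; rewrite /law /=; case: eqP => //= b0; case: eqP => //= z0.
  by case: ne; rewrite b0 z0.
Qed.

(** The first spine vertex has a random rank; for each value [v] its step is independent of the
    spine mark, with a law that does not depend on [v]. *)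
Lemma spine_position1 x : (forall x y, 0 <= w x y) ->
  mu [set f | spine_position 1 f = x] = (trans w 0 x)%:E.
Proof.
move=> w0; have mx := @measurable_spine_position 1 x.
have ctv : countable [set: vertex] by exact: countableP.
have mv := @measurable_spine d 1.
rewrite (total_probability mu ctv mv mx).
transitivity (\esum_(v in [set: vertex]) ((trans w 0 x)%:E *
    mu (setT `&` [set f | spn f 1 = v])))%E; last first.
  rewrite esumZl // -?(total_probability mu ctv mv) //.
    by rewrite (product_lawT pmu) mule1.
  by rewrite lee_fin divr_ge0 // fine_ge0 //; apply: esum_ge0 => *; rewrite lee_fin.
apply: eq_esum => v _; rewrite setTI.
transitivity (mu ([set f | spn f 1 = v] `&` [set f | (f (Step v 0)).2 = x])).
  congr (mu _); apply/seteqP; split => f /=; rewrite /spine_position /= add0r.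
    by move=> [fx fv]; rewrite -fv.
  by move=> [fv]; rewrite -fv.
rewrite (@product_law_indep _ _ _ _ _ [set Spine d 0] [set Step v 0] _ _ pmu) //.
- by rewrite step_marginal // add0r muleC.
- by move=> i -> .
- by move=> f g fg /=; rewrite fg.
- by move=> f g fg /=; rewrite fg.
- exact: (@measurable_mark d _ [set t | t.2 = x]).
Qed.

Lemma some_site_io_harmonic : (forall x y, 0 <= w x y) ->
  mu (@some_site_io d) = (\esum_(x in [set: zd d])
    ((trans w 0 x)%:E * mu (rebase [::] x @^-1` @some_site_io d)))%E.
Proof.
move=> w0; have mE := @measurable_some_site_io d.
have ctx : countable [set: zd d] by exact: countableP.
rewrite (total_probability mu ctx (@measurable_spine_position 1) mE).
apply: eq_esum => x _; rewrite -(spine_position1 x w0).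
have := @spine_markov 1 x setT measurableT (fun _ _ _ _ => Logic.I).
by rewrite !setTI setIC.
Qed.

End SpineMarkov.

(** * From one site to its neighbours *)

Section Irreducibility.
Context (R : realType) (d : nat).
Local Notation spn := (spine (config_choices d)).
Local Notation tree := (in_tree (config_choices d)).
Local Notation off := (offspring (config_choices d)).
Local Notation pos := (snake (config_choices d)).
Local Notation vis := (visits (config_choices d)).
Implicit Types (f g : config d).

(** Local finiteness, by which infinitely many visits must reach arbitrarily late generations. *)
Lemma finite_generations f m : finite_set [set u | tree f u /\ (size u < m)%N].
Proof.
elim: m => [|m IHm].
  by rewrite (_ : mkset _ = set0) // -subset0 => u [].
apply: (@sub_finite_set _ _ ([set [::]] `|`
  \bigcup_(v in [set u | tree f u /\ (size u < m)%N])
    [set j :: v | j in `I_(off f v)])).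
  move=> [|j v] /=; first by left.
  by move=> [/andP[fv jv] vm]; right; exists v => //=; exists j.
rewrite finite_setU; split; first exact: (finite_set1 [::]).
by apply: bigcup_finite => // v _; apply: finite_image; exact: finite_II.
Qed.

Lemma visited_io_unbounded f x m : visited_io (config_choices d) f x ->
  exists2 u, (m <= size u)%N & vis f x u.
Proof.
move=> fx; apply: contrapT => nu; apply: fx.
apply: sub_finite_set (finite_generations f m) => u [/= fu ux]; split=> //.
by rewrite ltnNge; apply/negP => mu; apply: nu; exists u.
Qed.

Lemma not_visited_io_bounded f y : ~ visited_io (config_choices d) f y ->
  exists N, forall u, vis f y u -> (size u < N)%N.
Proof.
move=> /contrapT /finite_seqP[s sE]; exists (\max_(u <- s) size u).+1 => u.
rewrite sE /= => us.
by rewrite ltnS (big_rem _ us) /= leq_maxl.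
Qed.

(** Breadth-first order with ties broken by [pickle]: minima are unique, and comparison never looks
    at later generations. *)
Definition precedes (u' u : vertex) : Prop :=
  (size u' < size u)%N \/ size u' = size u /\ (pickle u' < pickle u)%N.

Definition first_visit (x : zd d) m (u : vertex) : set (config d) :=
  [set f | [/\ (m <= size u)%N, vis f x u &
    forall u', (m <= size u')%N -> precedes u' u -> ~ vis f x u']].

Lemma first_visit_exists f x m : (exists2 u, (m <= size u)%N & vis f x u) ->
  exists u, first_visit x m u f.
Proof.
move=> [u0 mu0 fu0].
pose P n := `[< exists u, [/\ size u = n, (m <= size u)%N & vis f x u] >].
have exP : exists n, P n by exists (size u0); apply/asboolP; exists u0.
case: (ex_minnP exP) => M /asboolP[u1 [u1M mu1 fu1]] minM.
pose P' k := `[< exists u, [/\ pickle u = k, size u = M & vis f x u] >].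
have exP' : exists k, P' k by exists (pickle u1); apply/asboolP; exists u1.
case: (ex_minnP exP') => k /asboolP[u [uk uM fu]] mink.
exists u; split=> // [|u' mu' [lt|[eq lt]] fu'].
- by rewrite uM -u1M.
- move: lt; rewrite uM ltnNge => /negP; apply; apply: minM.
  by apply/asboolP; exists u'.
- move: lt; rewrite uk ltnNge => /negP; apply; apply: mink.
  by apply/asboolP; exists u'; split; rewrite ?eq.
Qed.

Lemma first_visit_inj f x m u u' :
  first_visit x m u f -> first_visit x m u' f -> u = u'.
Proof.
move=> [mu fu min] [mu' fu' min'].
have [lt|lt|sz] := ltngtP (size u) (size u').
- by case: (min' u mu (or_introl lt)).
- by case: (min u' mu' (or_introl lt)).
have [lt|lt|/(pcan_inj pickleK)//] := ltngtP (pickle u) (pickle u').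
- by case: (min' u mu (or_intror (conj sz lt))).
- by case: (min u' mu' (or_intror (conj (esym sz) lt))).
Qed.

Lemma measurable_visits x u : measurable [set f | vis f x u].
Proof.
apply: measurable_conj; first exact: measurable_in_tree.
exact: measurable_snake.
Qed.

Lemma measurable_first_visit x m u : measurable (first_visit x m u).
Proof.
rewrite (_ : first_visit x m u = [set f | (m <= size u)%N /\ (vis f x u /\
    forall u', (m <= size u')%N -> precedes u' u -> ~ vis f x u')]); last first.
  by apply/seteqP; split=> f; [case|move=> [? [? ?]]].
apply: measurable_conj; first exact: measurable_const.
apply: measurable_conj; first exact: measurable_visits.
apply: measurable_forall => [|u']; first exact: countableP.
apply: measurable_impl; first exact: measurable_const.
apply: measurable_impl; first exact: measurable_const.
apply: measurable_negation; exact: measurable_visits.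
Qed.

Lemma visits_depends x u n : (size u <= n)%N ->
  depends_on (@past d n) [set f | vis f x u].
Proof.
move=> un f g fg [fu ux]; split.
  rewrite /= -(@in_tree_agree d u f g) // => i pi _; apply: fg.
  exact: past_le un i pi.
rewrite /= -(@snake_agree d u f g) // => i pi _; apply: fg.
exact: past_le un i pi.
Qed.

(** Minimality concerns only generations up to that of [u], so the first visitor behaves like a
    stopping time. *)
Lemma first_visit_depends x m u : depends_on (@past d (size u)) (first_visit x m u).
Proof.
move=> f g fg [mu fu min]; split => //; first exact: (visits_depends (leqnn _) fg).
move=> u' mu' pu gu'; apply: (min u') => //.
have u'u : (size u' <= size u)%N by case: pu => [/ltnW|[->]].
by apply: (visits_depends u'u _ gu') => i pi; apply/esym/fg.
Qed.

Definition first_visitor (x : zd d) m f : option vertex :=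
  if pselect (exists u, first_visit x m u f) is left e then Some (projT1 (cid e))
  else None.

Lemma first_visitorP x m f u :
  first_visitor x m f = Some u <-> first_visit x m u f.
Proof.
rewrite /first_visitor; case: pselect => [e|ne]; last first.
  by split=> // fu; case: ne; exists u.
split=> [[<-]|fu]; first exact: projT2 (cid e).
by congr Some; apply: first_visit_inj fu; exact: projT2 (cid e).
Qed.

Lemma first_visitor_some x m f : (exists2 u, (m <= size u)%N & vis f x u) ->
  first_visitor x m f <> None.
Proof.
by move=> /first_visit_exists[u /first_visitorP ->].
Qed.

Lemma measurable_first_visitor x m : discretely_measurable (first_visitor x m).
Proof.
have mS u : measurable [set f | first_visitor x m f = Some u].
  rewrite (_ : mkset _ = first_visit x m u); first exact: measurable_first_visit.
  by apply/seteqP; split => f /= /first_visitorP.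
case=> [u|]; first exact: mS.
rewrite (_ : mkset _ = [set f | ~ exists u, first_visitor x m f = Some u]).
  apply: measurable_negation; apply: measurable_exists => //; exact: countableP.
apply/seteqP; split => f /=; first by move=> -> [].
by case: first_visitor => // u; case; exists u.
Qed.

Context (q : nat -> R).
Hypothesis hq : critical_offspring q.
Variables (w : env R d) (mu : {measure set (config d) -> \bar R}).
Hypothesis pmu : product_law (law q w) mu.
Variables (x y : zd d).
Hypothesis xy : 0 < trans w x y.

(** The last clause guarantees that each spine vertex has a child of rank 0, which the bound below
    needs when the visitor of [x] is on the spine. *)
Definition escaping (N : nat) : set (config d) :=
  [set f | [/\ forall m, exists2 u, (m <= size u)%N & vis f x u,
    forall u, vis f y u -> (size u < N)%N &
    forall n, ((f (Spine d n)).1.2 < (f (Spine d n)).1.1)%N]].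

Lemma measurable_escaping N : measurable (escaping N).
Proof.
rewrite (_ : escaping N = [set f |
    (forall m, exists u, (m <= size u)%N /\ vis f x u) /\
    ((forall u, vis f y u -> (size u < N)%N) /\
    forall n, ((f (Spine d n)).1.2 < (f (Spine d n)).1.1)%N)]); last first.
  apply/seteqP; split=> f.
    move=> [H1 H2 H3]; split=> // m; have [u ? ?] := H1 m; by exists u.
  move=> [H1 [H2 H3]]; split=> // m; have [u [? ?]] := H1 m; by exists u.
apply: measurable_conj.
  apply: measurable_forall => [|m]; first exact: countableP.
  apply: measurable_exists => [|u]; first exact: countableP.
  apply: measurable_conj; first exact: measurable_const.
  exact: measurable_visits.
apply: measurable_conj.
  apply: measurable_forall => [|u]; first exact: countableP.
  apply: measurable_impl; last exact: measurable_const.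
  exact: measurable_visits.
apply: measurable_forall => [|n]; first exact: countableP.
exact: (@measurable_mark d _ [set t | (t.1.2 < t.1.1)%N]).
Qed.

(* Each visit of x gives, independently of the past, a visit of y in the next
   generation with probability at least c; so k visits of x without a later
   visit of y have probability at most (1 - c)^k. *)
Lemma escaping_bound N : exists2 c : R, 0 < c <= 1 &
  forall k m W, (N <= m)%N -> measurable W -> depends_on (@past d m) W ->
    (mu (W `&` escaping N) <= ((1 - c) ^+ k)%:E * mu W)%E.
Proof.
have [k0 k02 qk0] := critical_branching hq.
pose a (i : label d) : mark d :=
  if i is inl _ then (k0, 0%N, 0) else (0%N, 0%N, y - x).
(* Child 0 of [u] steps from [x] to [y], and the [Off] mark of [u] gives [k0] children. If [u] is on
   the spine this mark is not read, but keeping it gives every [hit u] the same probability [c]. *)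
pose hit u := cylinder [:: Off d u; Step (0%N :: u) x] a.
pose c := q k0 * trans w x y.
have hitE u : mu (hit u) = c%:E.
  rewrite pmu ?big_cons ?big_nil //= /law /= !eqxx mulr1 /c.
  by rewrite [x + _]addrC subrK.
have mhit u : measurable (hit u) by exact: measurable_cylinder.
exists c.
  rewrite mulr_gt0 //= -lee_fin -(hitE [::]); exact: product_law_le1 pmu _.
have mG := measurable_escaping N.
elim=> [|k IHk] m W Nm mW dW.
  by rewrite expr0 mul1e; apply: le_measure; rewrite ?inE //; exact: measurableI.
have cto : countable [set: option vertex] by exact: countableP.
have c1 : 0 <= 1 - c.
  rewrite subr_ge0 -lee_fin -(hitE [::]); exact: product_law_le1 pmu _.
have mF := measurable_first_visitor x m.
(* Split over the first visitor of [x] from generation [m] on; it exists on [escaping N], so [None]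
   contributes nothing to the left side. *)
rewrite (total_probability mu cto mF (measurableI _ _ mW mG)).
rewrite (total_probability mu cto mF mW) -esumZl //; last first.
  by rewrite lee_fin exprn_ge0.
apply: le_esum => -[u|] _; last first.
  rewrite (_ : _ `&` _ = set0) ?measure0 ?mule_ge0 ?lee_fin ?exprn_ge0 //.
  by rewrite -subset0 => f /= [[_ [/(_ m) /first_visitor_some]]].
have FE A : A `&` [set f | first_visitor x m f = Some u] =
    A `&` first_visit x m u.
  by apply/seteqP; split => f /= [? /first_visitorP].
rewrite !{}FE; have mV := measurable_first_visit x m u.
have [mu_|mu_] := leqP m (size u); last first.
  rewrite (_ : _ `&` _ = set0) ?measure0 ?mule_ge0 ?lee_fin ?exprn_ge0 //.
  by rewrite -subset0 => f /= [_ [/(leq_trans mu_)]]; rewrite ltnn.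
(* On [escaping N] the visitor [u] cannot be hit, as its child would visit [y] too late. So the
   induction hypothesis applies to [W'], which is decided by generation [(size u).+1]. *)
pose W' := (W `&` first_visit x m u) `&` ~` hit u.
have mW1 : measurable (W `&` first_visit x m u) by exact: measurableI.
have mW' : measurable W' by apply: measurableI => //; exact: measurableC.
have dW1 : depends_on (@past d (size u)) (W `&` first_visit x m u).
  apply: depends_onI; last exact: first_visit_depends.
  by apply: depends_onS dW; exact: past_le.
have dhit : depends_on [set i | i \in [:: Off d u; Step (0%N :: u) x]] (hit u).
  by move=> f g fg fh i ih; rewrite -fg // fh.
have W'E : mu W' = ((1 - c)%:E * mu (W `&` first_visit x m u))%E.
  rewrite (@product_law_indep _ _ _ _ _ (@past d (size u))
    [set i | i \in [:: Off d u; Step (0%N :: u) x]] _ _ pmu) //.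
  - by rewrite (product_law_setC pmu) // hitE muleC.
  - by move=> i; rewrite /= !inE => /[swap] /orP[/eqP ->|/eqP ->] /=; rewrite ltnn.
  - exact: depends_onC.
  - exact: measurableC.
rewrite exprSr EFinM -muleA. rewrite -W'E.
apply: le_trans (IHk (size u).+1 W' (leq_trans Nm (leqW mu_)) mW' _).
  apply: le_measure; rewrite ?inE //.
  - by apply: measurableI => //; exact: measurableI.
  - exact: measurableI.
  move=> f [[Wf Gf] Vf]; split=> //; split; first by split.
  move=> hitf; have [_ yf spf] := Gf; have [_ [fu ux] _] := Vf.
  suff : vis f y (0%N :: u).
    by move=> /yf /=; rewrite ltnNge (leq_trans Nm) // leqW.
  have hOff : f (Off d u) = (k0, 0%N, 0) by rewrite hitf // !inE eqxx.
  have hStep : f (Step (0%N :: u) x) = (0%N, 0%N, y - x).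
    by rewrite hitf // !inE eqxx orbT.
  split=> /=; last by rewrite ux hStep /= addrC subrK.
  rewrite fu /= /offspring; case: eqP => _ /=.
    by apply: leq_ltn_trans (spf (size u)).
  by rewrite hOff /=; exact: ltnW.
apply: depends_onI; first by apply: depends_onS dW1; exact: past_le.
apply: depends_onC; apply: depends_onS dhit => i.
by rewrite /= !inE => /orP[/eqP ->|/eqP ->] /=.
Qed.

Lemma escaping_null N : mu (escaping N) = 0%E.
Proof.
have [c /andP[c0 c1] bound] := escaping_bound N.
have mG := measurable_escaping N.
have fin := product_law_fin pmu mG.
have g0 : 0 <= fine (mu (escaping N)) by rewrite fine_ge0 // measure_ge0.
rewrite -[LHS]fineK //; congr (_%:E); apply/eqP; rewrite eq_le g0 andbT.
have cvg0 : (1 - c) ^+ k @[k --> \oo] --> (0 : R).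
  apply: cvg_expr; rewrite ger0_norm ?subr_ge0 //.
  by rewrite ltrBlDr ltrDl.
rewrite -(cvg_lim _ cvg0) //; apply: limr_ge; first by apply/cvg_ex; exists 0.
apply: nearW => k; rewrite -lee_fin fineK //.
have := bound k N setT (leqnn _) measurableT (fun _ _ _ _ => Logic.I).
by rewrite setTI (product_lawT pmu) mule1.
Qed.

Lemma ae_visited_io_step : {ae mu, forall f,
  visited_io (config_choices d) f x -> visited_io (config_choices d) f y}.
Proof.
have aeN : {ae mu, forall f N, ~ escaping N f}.
  apply: ae_forall_countable => N; exists (escaping N); split.
  - exact: measurable_escaping.
  - exact: escaping_null.
  - by move=> f /= /contrapT.
apply: filterS2 aeN (ae_good hq pmu) => f nesc [spf _] fx.
apply: contrapT => /not_visited_io_bounded[N yN].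
by apply: (nesc N); split=> // m; exact: visited_io_unbounded.
Qed.

End Irreducibility.

(** * Environments *)

Section Lattice.
Context (R : realType) (d : nat).
Implicit Types (x y z : zd d).

Lemma enormN z : enorm R (- z) = enorm R z.
Proof.
by rewrite /enorm; congr Num.sqrt; apply: eq_bigr => i _; rewrite mxE rmorphN sqrrN.
Qed.

Lemma adjC x y : adj R x y = adj R y x.
Proof. by rewrite /adj -enormN opprB. Qed.

Lemma adj_translate x y z : adj R (y + x) (z + x) = adj R y z.
Proof. by rewrite /adj opprD addrACA subrr addr0. Qed.

Lemma adjxx x : adj R x x = false.
Proof.
rewrite /adj subrr /enorm big1; first by rewrite sqrtr0 eq_sym oner_eq0.
by move=> i _; rewrite mxE expr0n.
Qed.

Lemma adj_unit x (i : 'I_d) : adj R x (x + delta_mx 0 i).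
Proof.
rewrite /adj opprD addrA subrr add0r enormN /enorm (bigD1 i) //= mxE !eqxx /=.
rewrite expr1n big1 ?addr0 ?sqrtr1 // => j ji.
by rewrite mxE (negbTE ji) andbF /= expr0n.
Qed.

(** The vectors whose translation preserves [S] are closed under addition and contain the unit
    vectors and their opposites. *)
Lemma lattice_connected (S : zd d -> Prop) x0 :
  S x0 -> (forall x y, adj R x y -> S x -> S y) -> forall x, S x.
Proof.
move=> Sx0 Sadj x; rewrite -(subrK x0 x) addrC.
pose good z := forall y, S y -> S (y + z).
have good0 : good 0 by move=> y; rewrite addr0.
have goodD z z' : good z -> good z' -> good (z + z').
  by move=> gz gz' y /gz /gz'; rewrite addrA.
have good_mul z k : good z -> good (z *+ k).
  by move=> gz; elim: k => [|k IHk]; rewrite ?mulr0n // mulrS; exact: goodD.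
suff : good (x - x0) by apply.
rewrite (row_sum_delta (x - x0)); elim/big_ind: _ => // i _.
have goodU : good (delta_mx 0 i) by move=> y; apply: Sadj; exact: adj_unit.
have goodUN : good (- delta_mx 0 i).
  by move=> y; apply: Sadj; rewrite adjC -{2}(subrK (delta_mx 0 i) y) adj_unit.
case: ((x - x0) 0 i) => k.
  by rewrite -natz scaler_nat; exact: good_mul.
by rewrite NegzE -natz scaleNr scaler_nat -mulNrn; exact: good_mul.
Qed.

(** The vectors with coordinates in -1, 0, 1: a finite symmetric range for both models, holding at a
    trap included, so that sums over sites become finite. *)
Definition unit_box : seq (zd d) :=
  [seq \row_i ((g i : nat)%:Z - 1) | g : {ffun 'I_d -> 'I_3}].

Lemma mem_unit_box z : (z \in unit_box) = [forall i, `|z 0 i| <= 1].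
Proof.
rewrite /unit_box; apply/mapP/forallP => [[g _ ->] i|zb].
  rewrite mxE; have := ltn_ord (g i); case: (nat_of_ord (g i)) => [|[|[|]]] //=.
exists [ffun i => inord (absz (z 0 i + 1))]; first by rewrite mem_enum.
apply/rowP => i; rewrite mxE ffunE inordK; last first.
  by have := zb i; lia.
by rewrite gez0_abs ?addrK //; have := zb i; lia.
Qed.

Lemma unit_box_uniq : uniq unit_box.
Proof.
rewrite map_inj_uniq ?enum_uniq // => g g' /rowP gg'; apply/ffunP => i.
by apply: ord_inj; have := gg' i; rewrite !mxE => /addIr [].
Qed.

Lemma unit_boxN : perm_eq (map -%R unit_box) unit_box.
Proof.
apply: uniq_perm; first by rewrite map_inj_uniq ?unit_box_uniq //; exact: oppr_inj.
  exact: unit_box_uniq.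
move=> z; rewrite -{1}(opprK z) mem_map; last exact: oppr_inj.
by rewrite !mem_unit_box; apply: eq_forallb => i; rewrite mxE normrN.
Qed.

Lemma adj_unit_box x z : adj R x (x + z) -> z \in unit_box.
Proof.
rewrite /adj opprD addrA subrr add0r enormN mem_unit_box => /eqP nz.
apply/forallP => i; rewrite -(ler_int R).
have : (`|z 0 i|%:~R : R) ^+ 2 <= 1.
  suff : (`|z 0 i|%:~R : R) ^+ 2 <= enorm R z ^+ 2 by rewrite nz expr1n.
  rewrite /enorm sqr_sqrtr; last first.
    by apply: sumr_ge0 => j _; exact: sqr_ge0.
  rewrite (bigD1 i) //= intr_norm real_normK ?num_real // lerDl.
  by apply: sumr_ge0 => j _; exact: sqr_ge0.
by rewrite -[leRHS](expr1n R 2) ler_pXn2r // ?nnegrE ?ler0z.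
Qed.

End Lattice.

(** * Common properties of conductances and traps *)

Section AdmissibleEnvironments.
Context (R : realType) (d : nat) (hd : (1 <= d)%N).
Implicit Types (w : env R d) (x y z : zd d).

Definition admissible w : Prop := random_conductances w \/ random_traps w.

Lemma admissible_ge0 w x y : admissible w -> 0 <= w x y.
Proof.
case=> [/(_ x y)[_ gt0 eq0]|[rho rho01 ->]].
  by have [/gt0/ltW|/eq0 ->] := boolP (adj R x y).
case: eqP => _; last by case: ifP.
by have /andP[r0 r1] := rho01 x; rewrite divr_ge0 // subr_ge0 ltW.
Qed.

Lemma admissible_sym w x y : admissible w -> w x y = w y x.
Proof.
case=> [/(_ x y)[]//|[rho _ wE]].
by rewrite !wE adjC eq_sym; case: eqP => // ->.
Qed.

Lemma admissible_far w x z : admissible w -> z \notin unit_box d -> w x (x + z) = 0.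
Proof.
move=> aw zn; have nadj : ~~ adj R x (x + z).
  by apply: contra zn; exact: adj_unit_box.
case: aw => [/(_ x (x + z))[_ _]|[rho _ ->]]; first exact.
rewrite (negbTE nadj); case: eqP => // /esym/eqP.
rewrite -[X in _ == X]addr0 (inj_eq (addrI _)) => /eqP z0.
move: zn; rewrite z0 mem_unit_box => /negP; case.
by apply/forallP => i; rewrite mxE normr0.
Qed.

Lemma admissible_adj w x y : admissible w -> adj R x y -> 0 < w x y.
Proof.
move=> aw xy; case: aw => [/(_ x y)[_ + _]|[rho _ ->]]; first exact.
case: eqP => [xE|_]; first by rewrite xE adjxx in xy.
by rewrite xy invr_gt0 ltr0n muln_gt0.
Qed.

Lemma admissible_shift w x : admissible w -> admissible (env_shift x w).
Proof.
case=> [cw|[rho rho01 wE]]; [left|right].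
  move=> y z; rewrite -(adj_translate R x) /env_shift; exact: cw.
exists (fun y => rho (y + x)) => [y|y z]; first exact: rho01.
by rewrite /env_shift wE adj_translate (inj_eq (addIr _)).
Qed.

Lemma admissible_pi w x : admissible w ->
  env_pi w x = (\sum_(z <- unit_box d) w x (x + z))%:E.
Proof.
move=> aw; rewrite /env_pi.
have bij : set_bij [set: zd d] [set: zd d] (fun z => x + z).
  by split.
rewrite (reindex_esum _ _ _ _ bij).
rewrite (esumID [set` unit_box d]); last by move=> *; rewrite lee_fin admissible_ge0.
rewrite setTI [X in (_ + X)%E]esum1 ?adde0; last first.
  by move=> z [_ /= /negP zn]; rewrite admissible_far.
rewrite esum_fset; [|exact: finite_seq|by move=> *; rewrite lee_fin admissible_ge0].
by rewrite -fsbig_seq ?unit_box_uniq // sumEFin.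
Qed.

Lemma admissible_trans_gt0 w x y : admissible w -> adj R x y -> 0 < trans w x y.
Proof.
move=> aw xy; have wxy := admissible_adj aw xy.
rewrite /trans divr_gt0 // admissible_pi //= (big_rem (y - x)); last first.
  by apply: (@adj_unit_box R d x); rewrite addrC subrK.
by rewrite /= [x + _]addrC subrK ltr_wpDr // sumr_ge0 // => z _; exact: admissible_ge0.
Qed.

End AdmissibleEnvironments.

(** * Stationarity and vanishing of the Dirichlet form *)

Section EnvironmentMeasure.
Context (R : realType) (d : nat) (hd : (1 <= d)%N).
Implicit Types (w : env R d) (x y z : zd d).

Lemma measurable_weight x y : measurable_fun setT (fun w : env R d => w x y).
Proof.
move=> _ B mB; rewrite setTI; apply: sub_sigma_algebra.
by exists x, y, B.
Qed.

Lemma measurable_env_shift x : measurable_fun setT (@env_shift R d x).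
Proof.
apply: (measurability (rT := env R d) (@env_cylinders R d)) => //.
move=> _ [_ [y [z [B mB ->]]] <-].
rewrite setTI; apply: sub_sigma_algebra.
by exists (y + x), (z + x), B.
Qed.

Lemma env_shiftD x z w : env_shift z (env_shift x w) = env_shift (z + x) w.
Proof.
by apply/funext => y; apply/funext => y'; rewrite /env_shift !addrA.
Qed.

Variable P : probability (env R d) R.
Hypothesis hstat : stationary P.

Lemma ae_env_shift (A : env R d -> Prop) x :
  {ae P, forall w, A w} -> {ae P, forall w, A (env_shift x w)}.
Proof.
move=> [N [mN N0 AN]]; exists (env_shift x @^-1` N); split.
- by rewrite -[X in measurable X]setTI; exact: measurable_env_shift.
- by rewrite /= -N0; exact: hstat.
- by move=> w /= nA; apply: AN.
Qed.

Lemma stationary_integral x (f : env R d -> \bar R) :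
  measurable_fun setT f -> (forall w, 0 <= f w)%E ->
  (\int[P]_w f (env_shift x w) = \int[P]_w f w)%E.
Proof.
move=> mf f0; have ms := measurable_env_shift x.
have := ge0_integral_pushforward ms P measurableT mf (fun w _ => f0 w).
rewrite preimage_setT => <-.
apply: (eq_measure_integral P (m1 := image_measure P ms)) => A mA _.
exact: hstat.
Qed.

(** The integral of a nonnegative function is a supremum over simple functions below it, so
    monotonicity requires no measurability. It is applied with [env_pi] as the larger function. *)
Lemma le_integral_nonmeasurable disp (T : measurableType disp)
    (mu : {measure set T -> \bar R}) (f g : T -> \bar R) :
  (forall t, 0 <= f t)%E -> (forall t, f t <= g t)%E ->
  (\int[mu]_t f t <= \int[mu]_t g t)%E.
Proof.
move=> f0 fg; have g0 t : (0 <= g t)%E by exact: le_trans (fg t).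
rewrite !ge0_integralTE //; apply: ereal_sup_le => _ [h hf <-].
by exists h => // t; exact: le_trans (fg t).
Qed.

Hypothesis hadm : {ae P, forall w, admissible w}.
Hypothesis hint : (\int[P]_w env_pi w (0%R : zd d) < +oo)%E.

(** The absolute value ensures nonnegativity in every environment, not merely the admissible
    ones. *)
Definition conductance w z : R := `|w 0 z|.

Lemma measurable_conductance z : measurable_fun setT (conductance ^~ z).
Proof.
by apply: measurableT_comp (measurable_weight 0 z).
Qed.

Lemma integrable_conductances :
  (\int[P]_w (\sum_(z <- unit_box d) conductance w z)%:E < +oo)%E.
Proof.
have [N [mN N0 admN]] := hadm.
pose f w := ((\sum_(z <- unit_box d) conductance w z)%:E)%E.
have f0 w : (0 <= f w)%E.
  by rewrite lee_fin; apply: sumr_ge0 => z _; exact: normr_ge0.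
have mf : measurable_fun setT f.
  apply/measurable_EFinP; apply: measurable_sum => z.
  exact: measurable_conductance.
(* The comparison with [env_pi] is known only in admissible environments, so [f] is cut off on the
   null set [N]. *)
pose g := (f \_ (~` N)).
have g0 w : (0 <= g w)%E by rewrite /g patchE; case: ifP.
have -> : (\int[P]_w (\sum_(z <- unit_box d) conductance w z)%:E =
    \int[P]_w g w)%E.
  apply: ge0_ae_eq_integral => //.
    apply/(measurable_restrictT _ _).1; first exact: measurableC.
    exact: measurable_funS mf.
    by move=> w _; exact: f0.
  have aN : {ae P, forall w, ~ N w} by exists N; split=> // w /= /contrapT.
  by apply: filterS aN => w nN _; rewrite /g patchE mem_set.
apply: le_lt_trans hint; apply: le_integral_nonmeasurable => // w.
rewrite /g patchE; case: ifPn => [|_]; last first.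
  by apply: esum_ge; exists set0; [exact: fsets_set0|rewrite fsbig_set0].
rewrite inE /= => nN; have aw : admissible w.
  by apply: contrapT => naw; apply: nN; apply: admN.
rewrite admissible_pi // lee_fin ler_sum // => z _.
by rewrite add0r /conductance ger0_norm // admissible_ge0.
Qed.

Variable r : env R d -> R.
Hypothesis mr : measurable_fun setT r.
Hypothesis r01 : forall w, 0 <= r w <= 1.
Hypothesis harmonic : {ae P, forall w,
  \sum_(z <- unit_box d) w 0 z * r (env_shift z w) =
  (\sum_(z <- unit_box d) w 0 z) * r w}.

(* Expanding the square and using harmonicity,
   sum_z w(0,z) (r w - r (tau_z w))^2 + pi(w) (r w)^2 =
   sum_z w(0,z) (r (tau_z w))^2; by stationarity and symmetry of w the last
   two terms have the same finite integral. *)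
Lemma harmonic_invariant : {ae P, forall w x, r (env_shift x w) = r w}.
Proof.
pose box := unit_box d.
pose gap w := \sum_(z <- box) conductance w z * (r w - r (env_shift z w)) ^+ 2.
pose here w := \sum_(z <- box) conductance w z * r w ^+ 2.
pose there w := \sum_(z <- box) conductance w z * r (env_shift z w) ^+ 2.
have mrs z : measurable_fun setT (fun w => r (env_shift z w)).
  exact: measurableT_comp mr (measurable_env_shift z).
have mterm (g : env R d -> R) z : measurable_fun setT g ->
    measurable_fun setT (fun w => conductance w z * g w ^+ 2).
  move=> mg; apply: measurable_funM; first exact: measurable_conductance.
  exact: measurable_funX.
have term0 z w (a : R) : 0 <= conductance w z * a ^+ 2.
  by rewrite /conductance mulr_ge0 ?normr_ge0 ?sqr_ge0.
have mgap : measurable_fun setT gap.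
  by apply: measurable_sum => z; apply: mterm; exact: measurable_funB.
have mhere : measurable_fun setT here by apply: measurable_sum => z; exact: mterm.
have mthere : measurable_fun setT there by apply: measurable_sum => z; exact: mterm.
have gap0 w : 0 <= gap w by apply: sumr_ge0 => z _; exact: term0.
have here0 w : 0 <= here w by apply: sumr_ge0 => z _; exact: term0.
have there0 w : 0 <= there w by apply: sumr_ge0 => z _; exact: term0.
have finhere : (\int[P]_w (here w)%:E < +oo)%E.
  apply: le_lt_trans integrable_conductances; apply: ge0_le_integral => //.
  - by move=> w _; rewrite lee_fin.
  - exact/measurable_EFinP.
  - apply/measurable_EFinP; apply: measurable_sum => z; exact: measurable_conductance.
  move=> w _; rewrite lee_fin ler_sum // => z _.
  have /andP[r0 r1] := r01 w.
  by rewrite ler_piMr ?normr_ge0 // expr_le1.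
have swap : (\int[P]_w (there w)%:E = \int[P]_w (here w)%:E)%E.
  have E (F : env R d -> zd d -> R) : (forall z, measurable_fun setT (F ^~ z)) ->
      (forall w z, 0 <= F w z) ->
      (\int[P]_w (\sum_(z <- box) F w z)%:E = \sum_(z <- box) \int[P]_w (F w z)%:E)%E.
    move=> mF F0; under eq_integral do rewrite -sumEFin.
    rewrite ge0_integral_sum // => [z|z w _]; last by rewrite lee_fin.
    exact/measurable_EFinP.
  rewrite /there /here !E //; last 2 first.
  - by move=> z; exact: mterm.
  - by move=> z; exact: mterm.
  (* The term [z] of [there], shifted by [- z], has weight [w (- z) 0]; by symmetry this is the term
     [- z] of [here]. *)
  rewrite -[RHS](perm_big _ (unit_boxN d)) [RHS]big_map /=; apply: eq_bigr => z _.
  rewrite -(stationary_integral (- z)) //; last first.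
    by move=> w; rewrite lee_fin.
    by apply/measurable_EFinP; exact: mterm.
  apply: ge0_ae_eq_integral => //.
  - apply: (@measurableT_comp _ _ _ _ _ _
      (fun w => (conductance w z * r (env_shift z w) ^+ 2)%:E) _
      _ _ (measurable_env_shift (- z))).
    by apply/measurable_EFinP; exact: (mterm (fun w => r (env_shift z w))).
  - apply/measurable_EFinP; exact: mterm.
  - by move=> w _; rewrite lee_fin.
  - by move=> w _; rewrite lee_fin.
  apply: filterS hadm => w aw _; rewrite env_shiftD subrr env_shift0.
  congr (_ * _)%:E; rewrite /conductance /env_shift.
  by rewrite add0r subrr (admissible_sym _ _ aw).
have split : (\int[P]_w (gap w)%:E + \int[P]_w (here w)%:E =
    \int[P]_w (there w)%:E)%E.
  rewrite -ge0_integralD //; last 4 first.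
  - by move=> w _; rewrite lee_fin.
  - exact/measurable_EFinP.
  - by move=> w _; rewrite lee_fin.
  - exact/measurable_EFinP.
  apply: ge0_ae_eq_integral => //.
  - apply: emeasurable_funD; exact/measurable_EFinP.
  - exact/measurable_EFinP.
  - by move=> w _; rewrite adde_ge0 ?lee_fin.
  - by move=> w _; rewrite lee_fin.
  apply: filterS2 hadm harmonic => w aw hw _; rewrite -EFinD; congr (_%:E).
  have cE z : conductance w z = w 0 z by rewrite /conductance ger0_norm // admissible_ge0.
  rewrite /gap /here /there -big_split /=.
  (* Harmonicity multiplied by [2 * r w]: a sum equal to 0 that absorbs the cross terms. *)
  have hw2 : \sum_(z <- box) (2 * r w * (w 0 z * r w) -
      2 * r w * (w 0 z * r (env_shift z w))) = 0.
    by rewrite sumrB -!big_distrr /= hw big_distrl /= subrr.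
  rewrite -[RHS]addr0 -[X in _ = _ + X]hw2 -big_split /=; apply: eq_bigr => z _.
  by rewrite cE; ring.
have gapint : (\int[P]_w (gap w)%:E = 0)%E.
  move: split; rewrite swap.
  have h0 : (0 <= \int[P]_w (here w)%:E)%E.
    by apply: integral_ge0 => w _; rewrite lee_fin.
  have g0 : (0 <= \int[P]_w (gap w)%:E)%E.
    by apply: integral_ge0 => w _; rewrite lee_fin.
  (* The common term may be cancelled because it is finite. *)
  move: h0 g0 finhere; case: (\int[P]_w (here w)%:E)%E => // a _.
  case: (\int[P]_w (gap w)%:E)%E => // b _ _ [].
  by move=> /eqP; rewrite -[X in _ == X]add0r (inj_eq (addIr _)) => /eqP ->.
have gapae : {ae P, forall w, gap w = 0}.
  have mg : measurable_fun setT (EFin \o gap) by exact/measurable_EFinP.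
  have /(ae_eq_integral_abs P measurableT mg) : (\int[P]_w `|(EFin \o gap) w| = 0)%E.
    by rewrite -gapint; apply: eq_integral => w _; rewrite gee0_abs // lee_fin.
  by apply: filterS => w /(_ Logic.I) [].
(* Invariance under unit translations at almost every [w] holds, by stationarity, at all its shifts
   simultaneously; this allows walking through the lattice. *)
have unit_step : {ae P, forall w x z, adj R 0 z ->
    r (env_shift z (env_shift x w)) = r (env_shift x w)}.
  apply: ae_forall_countable => x.
  apply: (ae_env_shift (A := fun w => forall z, adj R 0 z -> r (env_shift z w) = r w)).
  apply: filterS2 hadm gapae => w aw gw z az.
  have zb : z \in box by apply: (@adj_unit_box R d 0); rewrite add0r.
  move: gw; rewrite /gap => /eqP; rewrite psumr_eq0 // => /allP /(_ z zb) /=.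
  rewrite mulf_eq0 normr_eq0 gt_eqF ?admissible_adj //= sqrf_eq0 subr_eq0.
  by move=> /eqP.
apply: filterS unit_step => w hw.
apply: (@lattice_connected R d (fun x => r (env_shift x w) = r w) 0).
  by rewrite env_shift0.
move=> x y xy <-; rewrite -(subrK x y) -env_shiftD; apply: hw.
by rewrite -(adj_translate R x) add0r subrK.
Qed.

End EnvironmentMeasure.

(** * The zero-one law *)

Section ZeroOneLaw.
Context (R : realType) (d : nat) (hd : (1 <= d)%N) (q : nat -> R)
  (hq : critical_offspring q) (P : probability (env R d) R)
  (hadm : {ae P, forall w, admissible w})
  (hstat : stationary P) (herg : ergodic P)
  (hint : (\int[P]_w env_pi w (0%R : zd d) < +oo)%E)
  (disp : measure_display) (Om : measurableType disp) (xi : choices d Om)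
  (Q : R.-pker (env R d) ~> Om)
  (hQ : forall w : env R d, admissible w -> quenched_law q w xi (Q w)).
Implicit Type w : env R d.

Local Notation config_law w := (image_measure (Q w) (measurable_to_config xi)).

Definition some_io : set Om := [set o | exists x : zd d, visited_io xi o x].
Definition all_io : set Om := [set o | forall x : zd d, visited_io xi o x].

Lemma some_ioE : some_io = to_config xi @^-1` @some_site_io d.
Proof.
by apply/seteqP; split=> o [x ox]; exists x; move: ox; rewrite (visited_io_to_config xi).
Qed.

Lemma measurable_visited x : measurable [set o | visited_io xi o x].
Proof.
rewrite (_ : mkset _ = to_config xi @^-1` [set f | visited_io (config_choices d) f x]).
  rewrite -[X in measurable X]setTI.
  exact: (measurable_to_config xi measurableT (measurable_visited_io x)).
by apply/seteqP; split=> o /=; rewrite (visited_io_to_config xi).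
Qed.

Lemma measurable_some_io : measurable some_io.
Proof.
apply: measurable_exists => [|x]; first exact: countableP.
exact: measurable_visited.
Qed.

Lemma measurable_all_io : measurable all_io.
Proof.
apply: measurable_forall => [|x]; first exact: countableP.
exact: measurable_visited.
Qed.

Lemma config_product_law w : admissible w ->
  product_law (law q w) (config_law w).
Proof.
move=> aw; apply: quenched_product_law.
- exact: offspring_ge0.
- by move=> x y; exact: admissible_ge0.
- exact: hQ.
Qed.

Definition io_probability w : R := fine (Q w some_io).

Lemma Q_le1 w A : measurable A -> (Q w A <= 1)%E.
Proof.
by move=> mA; rewrite -(prob_kernel (s := Q) w); apply: le_measure; rewrite ?inE.
Qed.

Lemma io_probabilityE w : (io_probability w)%:E = Q w some_io.
Proof.
rewrite /io_probability fineK // ge0_fin_numE ?measure_ge0 //.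
by rewrite (le_lt_trans (Q_le1 w measurable_some_io)) ?ltry.
Qed.

Lemma io_probability01 w : 0 <= io_probability w <= 1.
Proof.
rewrite -!lee_fin io_probabilityE measure_ge0 /=.
exact: Q_le1 measurable_some_io.
Qed.

Lemma measurable_io_probability : measurable_fun setT io_probability.
Proof.
apply: measurableT_comp (measurable_kernel Q _ measurable_some_io).
exact: fine_measurable.
Qed.

(** The laws given by [Q] at two environments are compared: the restarted configuration under [Q w]
    and the configuration under [Q (env_shift x w)] follow the same product law. *)
Lemma io_probability_rebase w x : admissible w ->
  config_law w (rebase [::] x @^-1` @some_site_io d) =
  (io_probability (env_shift x w))%:E.
Proof.
move=> aw; rewrite io_probabilityE some_ioE.
exact: (product_law_unique (product_law_rebase [::] x (config_product_law aw))
  (config_product_law (admissible_shift x aw)) (@measurable_some_site_io d)).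
Qed.

Lemma io_probability_config w :
  config_law w (@some_site_io d) = (io_probability w)%:E.
Proof. by rewrite io_probabilityE some_ioE. Qed.

Lemma io_probability_harmonic w : admissible w ->
  \sum_(z <- unit_box d) w 0 z * io_probability (env_shift z w) =
  (\sum_(z <- unit_box d) w 0 z) * io_probability w.
Proof.
move=> aw; have w0 x y : 0 <= w x y by exact: admissible_ge0.
have piE : env_pi w 0 = (\sum_(z <- unit_box d) w 0 z)%:E.
  rewrite admissible_pi //; congr (_%:E); apply: eq_bigr => z _.
  by rewrite add0r.
have transE z : trans w 0 z = w 0 z / \sum_(z <- unit_box d) w 0 z.
  by rewrite /trans piE.
have pi_gt0 : 0 < \sum_(z <- unit_box d) w 0 z.
  (* The bound [1 <= d] provides a neighbour of 0, hence a positive weight. *)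
  pose z0 : zd d := 0 + delta_mx 0 (Ordinal hd).
  have az0 : adj R 0 z0 by exact: adj_unit.
  rewrite (big_rem z0) /=; last by apply: (@adj_unit_box R d 0); rewrite add0r.
  by rewrite ltr_wpDr ?admissible_adj // sumr_ge0.
have := some_site_io_harmonic hq (config_product_law aw) w0.
rewrite io_probability_config.
under eq_esum do rewrite io_probability_rebase // -EFinM.
have t0 z : 0 <= trans w 0 z * io_probability (env_shift z w).
  rewrite transE !mulr_ge0 ?invr_ge0 ?(ltW pi_gt0) //.
  by have /andP[] := io_probability01 (env_shift z w).
rewrite (esumID [set` unit_box d]); last by move=> z _; rewrite lee_fin.
rewrite setTI [X in (_ + X)%E]esum1 ?adde0; last first.
  move=> z [_ /= /negP zn]; rewrite transE -[z in w 0 z]add0r.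
  by rewrite admissible_far // !mul0r.
rewrite esum_fset; [|exact: finite_seq|by move=> *; rewrite lee_fin].
rewrite -fsbig_seq ?unit_box_uniq // sumEFin => -[->].
rewrite big_distrr /=; apply: eq_bigr => z _.
by rewrite transE [RHS]mulrC -!mulrA; congr (_ * _); rewrite mulrC mulfK ?gt_eqF.
Qed.

Lemma io_probability_01 : {ae P, forall w,
  (forall x, io_probability (env_shift x w) = io_probability w) /\
  (io_probability w = 0 \/ io_probability w = 1)}.
Proof.
have inv : {ae P, forall w x, io_probability (env_shift x w) = io_probability w}.
  apply: (harmonic_invariant hd hstat hadm hint measurable_io_probability
    io_probability01).
  by apply: filterS hadm => w; exact: io_probability_harmonic.
apply: filterS2 hadm inv => w aw hw; split=> //.
have := some_site_io_01 hq (config_product_law aw).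
rewrite io_probability_config => /(_ _) H.
have /H : forall x : zd d, config_law w (rebase [::] x @^-1` @some_site_io d) =
    (io_probability w)%:E.
  by move=> x; rewrite io_probability_rebase // hw.
rewrite -EFinM => -[/esym/eqP]; rewrite -subr_eq0 -{3}[io_probability w]mulr1.
rewrite -mulrBr mulf_eq0 subr_eq0 => /orP[/eqP|/eqP]; [by left|by right].
Qed.

Lemma all_io_of_some_io w : admissible w -> Q w some_io = 1%E -> Q w all_io = 1%E.
Proof.
move=> aw Q1; apply/eqP; rewrite eq_le (Q_le1 w measurable_all_io) /=.
pose all_config := [set f : config d | forall x, visited_io (config_choices d) f x].
have mall : measurable all_config.
  apply: measurable_forall => [|x]; first exact: countableP.
  exact: measurable_visited_io.
have -> : Q w all_io = config_law w all_config.
  rewrite /image_measure /= /pushforward; congr (Q w _).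
  apply/seteqP; split=> o ox x; have := ox x; by rewrite (visited_io_to_config xi).
rewrite -Q1 some_ioE.
have step : {ae config_law w, forall f x y, adj R x y ->
    visited_io (config_choices d) f x -> visited_io (config_choices d) f y}.
  apply: ae_forall_countable => x; apply: ae_forall_countable => y.
  have [xy|nxy] := boolP (adj R x y); last exact: aeW.
  have txy : 0 < trans w x y by exact: admissible_trans_gt0.
  apply: filterS (ae_visited_io_step hq (config_product_law aw) txy) => f fx _.
  exact: fx.
apply: (@le_measure_ae _ _ _ (config_law w)) => //.
  exact: measurable_some_site_io.
apply: filterS step => f fxy [x0 fx0].
exact: (@lattice_connected R d (visited_io (config_choices d) f) x0).
Qed.

Lemma annealed_dichotomy :
  (annealed P Q some_io = 1%E /\ annealed P Q all_io = 1%E) \/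
  (annealed P Q some_io = 0%E /\ annealed P Q all_io = 0%E).
Proof.
(* Quantifying over all shifts makes [A] exactly invariant, as [ergodic] demands, whereas
   [io_probability] is invariant only almost surely. *)
pose A : set (env R d) := [set w | forall x, io_probability (env_shift x w) = 1].
have mA : measurable A.
  apply: measurable_forall => [|x]; first exact: countableP.
  have ms := measurableT_comp measurable_io_probability (measurable_env_shift x).
  by rewrite -[X in measurable X]setTI; exact: (ms measurableT [set 1]).
have invA x : env_shift x @^-1` A = A.
  apply/seteqP; split=> w wA y /=.
    by rewrite -(subrK x y) -env_shiftD; exact: wA.
  by rewrite /= env_shiftD; exact: wA.
have const (B : set Om) (c : \bar R) : measurable B -> (0 <= c)%E ->
    {ae P, forall w, Q w B = c} -> annealed P Q B = c.
  move=> mB c0 Bc; rewrite /annealed.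
  transitivity (\int[P]_w cst c w)%E; last first.
    rewrite integral_cst // -[RHS]mule1; congr (_ * _)%E.
    exact: probability_setT.
  apply: ge0_ae_eq_integral => //; first exact: measurable_kernel.
  by apply: filterS Bc => w.
have [PA|PA] := herg mA invA; [right|left].
- have nA : {ae P, forall w, ~ A w} by exists A; split=> // w /= /contrapT.
  have some0 : {ae P, forall w, Q w some_io = 0%E}.
    apply: filterS2 nA io_probability_01 => w nAw [hw [w0|w1]].
      by rewrite -io_probabilityE w0.
    by case: nAw => x; rewrite hw w1.
  split; first by apply: const => //; exact: measurable_some_io.
  apply: const => //; first exact: measurable_all_io.
  apply: filterS some0 => w w0; apply/eqP; rewrite eq_le measure_ge0 andbT -w0.
  apply: le_measure; rewrite ?inE; [exact: measurable_all_io|exact: measurable_some_io|].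
  by move=> o oall; exists 0.
- have aA : {ae P, forall w, A w}.
    apply: ae_setC0 => //; apply: etrans (probability_setC P mA) _.
    by rewrite PA subee.
  have some1 : {ae P, forall w, Q w some_io = 1%E}.
    apply: filterS aA => w /(_ 0); rewrite env_shift0 => w1.
    by rewrite -io_probabilityE w1.
  split; first by apply: const => //; exact: measurable_some_io.
  apply: const => //; first exact: measurable_all_io.
  apply: filterS2 hadm some1 => w aw; exact: all_io_of_some_io.
Qed.

End ZeroOneLaw.

Theorem proposition1p3 (R : realType) (d : nat) (hd : (1 <= d)%N)
    (q : nat -> R) (hq : critical_offspring q)
    (P : probability (env R d) R)
    (henv : {ae P, forall w, random_conductances w} \/
            {ae P, forall w, random_traps w})
    (hstat : stationary P) (herg : ergodic P)
    (hint : (\int[P]_w env_pi w (0%R : zd d) < +oo)%E)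
    (disp : measure_display) (Om : measurableType disp) (xi : choices d Om)
    (Q : R.-pker (env R d) ~> Om)
    (hQ : forall w : env R d, random_conductances w \/ random_traps w ->
            quenched_law q w xi (Q w)) :
  let recurrent :=
    annealed P Q [set o | forall x : zd d, visited_io xi o x] = 1%E in
  let transient :=
    annealed P Q [set o | exists x : zd d, visited_io xi o x] = 0%E in
  (recurrent /\ ~ transient) \/ (~ recurrent /\ transient).
Proof.
have hadm : {ae P, forall w, admissible w}.
  by case: henv; apply: filterS => w hw; [left|right].
move=> recurrent transient.
have neq : (1%E : \bar R) <> 0%E by move/eqP; rewrite gt_eqF ?lte01.
have [[some1 all1]|[some0 all0]] :=
  annealed_dichotomy hd hq hadm hstat herg hint hQ; [left|right].
- by split=> // some0; apply: neq; rewrite -some1.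
- by split=> // all1; apply: neq; rewrite -all1.
Qed.
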